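(* For every $\epsilon>0$ there is a learning-augmented algorithm $\mathcal{A}$ for dynamic power management whose expected cost on every instance satisfies \[\mathrm{cost}(\mathcal{A})\le(1+\epsilon)\min\left\{\rho\,\mathrm{OPT}+\mu(\rho)\,\eta\ \middle|\ \rho\in\left[1,\tfrac{e}{e-1}\right]\right\}+O\!\left(\frac{\beta_k}{\epsilon}\log\frac1\epsilon\right).\]
   Context: Dynamic power management (DPM): there are states $0,1,\dots,k$ with power consumptions $\alpha_0>\alpha_1>\dots>\alpha_k\ge0$ and wake-up costs $0=\beta_0<\beta_1<\dots<\beta_k$. The input is a sequence of idle periods of lengths $\ell_1,\dots,\ell_T$ revealed online (the length of a period is known only when it ends). During each period, starting in state 0, the algorithm may over time transition to states with lower power consumption, paying $x\alpha_i$ for residing in state $i$ for time $x$; if $j$ is the state at the end of the period it pays wake-up cost $\beta_j$ and returns to state 0. At the beginning of period $i$ the algorithm receives a prediction $\tau_i\ge0$ of $\ell_i$; the prediction error is $\eta=\sum_i\alpha_0|\tau_i-\ell_i|$. $\mathrm{OPT}$ is the optimal offline cost. For $\rho\in[1,\frac{e}{e-1}]$, $\mu(\rho)=\max\left\{\frac{1-\rho\frac{e-1}{e}}{\ln 2},\ \rho(1-T)e^{-T}\right\}$, where $T\in[0,1]$ solves $T^2e^{-T}=1-\frac1\rho$. The constant in the $O(\cdot)$ is absolute (independent of the instance and of $\epsilon$). *)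

(* Defs.v *)
From HB Require Import structures.
From mathcomp Require Import all_boot all_order all_algebra.
From mathcomp Require Import all_classical all_reals all_analysis.
From mathcomp Require Import ring.

Set Implicit Arguments.
Unset Strict Implicit.
Unset Printing Implicit Defensive.

Import Order.TTheory GRing.Theory Num.Theory.
Import numFieldNormedType.Exports.

Local Open Scope classical_set_scope.
Local Open Scope ring_scope.

Record dpm_system (R : realType) := DPMSystem {
  nb_sleep : nat;
  alpha : 'I_nb_sleep.+1 -> R;
  beta : 'I_nb_sleep.+1 -> R;
  alpha_decr : forall i j : 'I_nb_sleep.+1, (i < j)%N -> alpha j < alpha i;
  alpha_ge0 : 0 <= alpha ord_max;
  beta0 : beta ord0 = 0;
  beta_incr : forall i j : 'I_nb_sleep.+1, (i < j)%N -> beta i < beta j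
}.

Arguments alpha {R} d i.
Arguments beta {R} d i.

Record period (R : realType) := Period {
  predicted : R;
  duration : R;
  predicted_ge0 : 0 <= predicted;
  duration_ge0 : 0 <= duration
}.

Section DPM.
Variables (R : realType) (D : dpm_system R).

Local Notation state := 'I_(nb_sleep D).+1.

(* The state occupied at each time t >= 0 since the beginning of the period, as
   long as the period has not ended (values at t < 0 are irrelevant).  Powers
   decrease with the index, so moving to lower power means moving to a larger
   index.  An immediate move to state i is the schedule that is 0 at time 0 and
   i at all t > 0. *)
Record schedule := Schedule {
  state_at :> R -> state;
  state_at0 : state_at 0 = ord0;
  state_at_homo : forall t u : R, 0 <= t -> t <= u ->
    (state_at t <= state_at u)%N
}.

Definition residence_time (s : schedule) (l : R) (i : state) : R :=
  fine (lebesgue_measure [set t : R | 0 <= t <= l /\ s t = i]).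

Definition period_cost (s : schedule) (l : R) : R :=
  \sum_(i : state) residence_time s l i * alpha D i + beta D (s l).

(* A deterministic online algorithm: the past periods (oldest first) and the
   prediction for the current period determine the schedule of that period.
   During a period the only further information is that it has not ended yet,
   which is accounted for by using the schedule only up to the end. *)
Definition policy := seq (period R) -> R -> schedule.

Fixpoint cost_from (A : policy) (past inst : seq (period R)) : R :=
  if inst is p :: inst' then
    period_cost (A past (predicted p)) (duration p)
    + cost_from A (rcons past p) inst'
  else 0.

Definition cost (A : policy) (inst : seq (period R)) : R :=
  cost_from A [::] inst.

(* A randomized online algorithm, as a probability distribution on
   deterministic ones. *)
Record algorithm := Algorithm {
  seed_display : measure_display;
  seed : measurableType seed_display;
  seed_prob : probability seed R;
  run : seed -> policy;
  measurable_cost : forall inst : seq (period R),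
    measurable_fun [set: seed] (fun w => cost (run w) inst)
}.

Definition expected_cost (A : algorithm) (inst : seq (period R)) : \bar R :=
  ('E_(seed_prob A) [fun w => cost (run w) inst])%E.

Definition offline_cost (inst : seq (period R))
    (S : 'I_(size inst) -> schedule) : R :=
  \sum_(i < size inst) period_cost (S i) (duration (tnth (in_tuple inst) i)).

Definition OPT (inst : seq (period R)) : R := inf (range (@offline_cost inst)).

Definition prediction_error (inst : seq (period R)) : R :=
  \sum_(p <- inst) alpha D ord0 * `|predicted p - duration p|.

End DPM.

Section Tradeoff.
Variable R : realType.

Local Notation e := (expR 1 : R).

Definition rho_range : set R := [set rho | 1 <= rho <= e / (e - 1)].

Definition mu_eq (rho T : R) : Prop :=
  0 <= T <= 1 /\ T ^+ 2 * expR (- T) = 1 - rho^-1.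

(* The solution exists and is unique when rho is in rho_range: see mu_TP and
   mu_eq_unique below. *)
Definition mu_T (rho : R) : R := xget 0 [set T | mu_eq rho T].

Definition mu (rho : R) : R :=
  Num.max ((1 - rho * ((e - 1) / e)) / ln 2)
          (rho * (1 - mu_T rho) * expR (- mu_T rho)).

Lemma mu_TP (rho : R) : rho_range rho -> mu_eq rho (mu_T rho).
Proof.
move=> /= /andP[r1 re]; apply: (@xgetPex _ 0 [set T | mu_eq rho T]).
have e1 : 1 < e by rewrite expR_gt1.
have r0 : 0 < rho by apply: lt_le_trans r1.
have cf : {within `[0, 1], continuous (fun T : R => T ^+ 2 * expR (- T))}.
  apply: continuous_subspaceT => x; apply: cvgM; first exact: exprn_continuous.
  apply: (@continuous_comp R R R -%R expR); last exact: continuous_expR.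
  exact: opp_continuous.
have [|T T01 eT] := IVT (@ler01 R) cf (v := 1 - rho^-1).
  rewrite expr0n /= mul0r expr1n mul1r expRN.
  have h : 0 <= 1 - rho^-1 <= e^-1.
    apply/andP; split; first by rewrite subr_ge0 invf_le1.
    rewrite lerBlDl -lerBlDr.
    have -> : 1 - e^-1 = (e / (e - 1))^-1.
      by rewrite invf_div mulrBl divff ?mul1r// gt_eqF// expR_gt0.
    by rewrite lef_pV2// posrE divr_gt0// ?expR_gt0// subr_gt0.
  have e0 : 0 <= e^-1 by rewrite invr_ge0 expR_ge0.
  by rewrite min_l// max_r.
by move: T01; rewrite in_itv/= => T01; exists T.
Qed.

Lemma mu_eq_unique (rho T U : R) : mu_eq rho T -> mu_eq rho U -> T = U.
Proof.
wlog TU : T U / T <= U.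
  move=> H hT hU; have [TU|/ltW UT] := leP T U; first exact: (H T U).
  by apply/esym; apply: (H U T).
move=> [/andP[T0 T1] eT] [/andP[U0 U1] eU].
apply/eqP; move: TU; rewrite le_eqVlt => /orP[//|TU]; exfalso.
have [T00|Tn0] := eqVneq T 0.
  move: eT; rewrite -eU T00 expr0n /= mul0r => /esym/eqP.
  rewrite mulf_eq0 sqrf_eq0 [expR _ == _]gt_eqF ?expR_gt0// orbF => /eqP U00.
  by rewrite U00 T00 ltxx in TU.
have Tp : 0 < T by rewrite lt_neqAle eq_sym Tn0.
suff : T ^+ 2 * expR (- T) < U ^+ 2 * expR (- U) by rewrite eT eU ltxx.
have -> : expR (- U) = expR (- T) * expR (T - U).
  by rewrite -expRD; congr expR; ring.
rewrite mulrCA -[ltLHS]mulrC ltr_pM2l ?expR_gt0//.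
have Up : 0 < U by exact: lt_trans TU.
apply: (@lt_le_trans _ _ (U ^+ 2 * (1 + (T - U)))); last first.
  by rewrite ler_pM2l ?exprn_gt0// expR_ge1Dx.
apply: (@lt_le_trans _ _ (U * T)); first by rewrite expr2 ltr_pM2r.
rewrite expr2 -mulrA ler_pM2l// -subr_ge0.
have -> : U * (1 + (T - U)) - T = (U - T) * (1 - U) by ring.
by rewrite mulr_ge0// subr_ge0// ltW.
Qed.

End Tradeoff.

(* Main.v *)
Require Import Defs.
From mathcomp Require Import all_boot all_order all_algebra.
From mathcomp Require Import all_classical all_reals all_analysis.
From mathcomp Require Import measurable_realfun.
From mathcomp Require Import ring lra.

Set Implicit Arguments.
Unset Strict Implicit.
Unset Printing Implicit Defensive.

Import Order.TTheory GRing.Theory Num.Theory.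
Import numFieldNormedType.Exports.

Local Open Scope classical_set_scope.
Local Open Scope ring_scope.

(* A convex chain of states splits the problem into independent ski
   rentals: leaving layer [j] has price [b_j], staying in it costs rate [r_j],
   and the scales [s_j = b_j / r_j] increase along the chain.

   Ski rental, normalised to price and rate 1, with prediction [y].  If [G x]
   is the probability of not having bought by time [x], the expected cost
   [c = 1 - G + int G] satisfies [c' = G - G'], so keeping [c] on the line
   [rho * x + mu * |y - x|] is a linear equation for [G].  The survival
   function below follows it greedily and then stays at a floor [v <= mu],
   where the cost grows more slowly than the error term.  It is feasible for
   every [y] as soon as
     [rho * z * expR (- z) <= rho - 1 + mu * z] for all [z >= 0] and
     [1 <= rho * (1 - 1 / e) + mu * (y - 1 + 2 * expR (- y))] for all [y >= 0];
   the tangent of [z * expR (- z)] at [T] and the minimum of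
   [y - 1 + 2 * expR (- y)], reached at [y = ln 2], turn these conditions into
   the two terms of [mu rho].  Since the survival function is monotone in the
   scale, one uniform seed drives all layers at once.

   The experts for a grid of values of [rho] are combined by multiplicative
   weights.  Their losses within a period are unbounded, so the discount
   [expR (- lam * loss)] is applied continuously inside the period, as a
   probability of giving up and going to the deepest state; the extra wake-up
   cost is a factor [1 + lam * beta_k], and the cost of the period telescopes
   against the logarithm of the total weight. *)

Lemma is_derive_ge0_le (R : realType) (f df : R -> R) (a b : R) : a <= b ->
  (forall t, a <= t <= b -> is_derive t 1 f (df t)) ->
  (forall t, a <= t <= b -> 0 <= df t) -> f a <= f b.
Proof.
move=> ab dfP df0.
have sub t : t \in `]a, b[ -> a <= t <= b.
  by rewrite in_itv /= => /andP[/ltW -> /ltW ->].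
apply: (@ger0_derive1_le_cc R f a b) => //.
- by move=> t /sub /dfP ?; exact: ex_derive.
- by move=> t /sub tab; have ? := dfP _ tab; rewrite derive1E derive_val df0.
- apply: continuous_in_subspaceT => t /set_mem /= /[!in_itv] /= /dfP ?.
  by apply/differentiable_continuous/derivable1_diffP; exact: ex_derive.
- by rewrite in_itv /= lexx.
- by rewrite in_itv /= lexx andbT.
Qed.

(** * Ski rental with a prediction *)

Section SkiRental.
Variables (R : realType) (rho mu : R).
Implicit Types x y z : R.

Definition tradeoff_pair : Prop :=
  [/\ 1 <= rho, 0 <= mu <= 1,
      forall z, 0 <= z -> rho * z * expR (- z) <= rho - 1 + mu * z &
      forall y, 0 <= y ->
        1 <= rho * (1 - expR (- 1)) + mu * (y - 1 + 2 * expR (- y))].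

Hypothesis rhomu : tradeoff_pair.

Let rho1 : 1 <= rho. Proof. by case: rhomu. Qed.
Let mu0 : 0 <= mu. Proof. by case: rhomu => _ /andP[]. Qed.
Let mu1 : mu <= 1. Proof. by case: rhomu => _ /andP[]. Qed.
Let tangent z : 0 <= z -> rho * z * expR (- z) <= rho - 1 + mu * z.
Proof. by case: rhomu => ? ? H _; exact: H. Qed.
Let median y : 0 <= y ->
  1 <= rho * (1 - expR (- 1)) + mu * (y - 1 + 2 * expR (- y)).
Proof. by case: rhomu => ? ? _ H; exact: H. Qed.

(** Probability of buying at time 0. The budget at time 0 allows [mu * y]; the second term is the
    atom [a] for which, without further buying, the cost [a + (1 - a) * y] at time [y] is exactly
    [rho * y]. *)
Definition ski_atom (y : R) : R :=
  if y < 1 then Num.min (mu * y) ((rho - 1) * y / (1 - y)) else mu * y.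

(** With atom [mu * y], the solution of [G - G' = rho - mu] is [rho - mu - K * expR x] for this [K].
    It is cut at 0 when buying nothing after the atom already stays within the budget up to [y]. *)
Definition ski_drift (y : R) : R := Num.max 0 (rho - 1 - mu * (1 - y)).

(** For [1 <= y] this is the value of [ski_greedy y] at time [y - 1], clipped to [[0, mu]]. With
    [K = ski_drift y], freezing the greedy solution at time [a] gives cost [mu * y + (rho - mu) * a
    + (rho - mu - K * expR a) * (y - a)] at time [y], which is least at [a = y - 1]. *)
Definition ski_floor (y : R) : R :=
  if y < 1 then Num.min mu (1 - ski_atom y)
  else Num.max 0 (Num.min mu (rho - mu - ski_drift y * expR (y - 1))).

(** Before [y] only the bracket moves, the outer exponential being 1; after [y] the bracket is
    frozen and [rho + mu - G] grows exponentially. The joint formula makes monotonicity visible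
    factor by factor. *)
Definition ski_greedy (y x : R) : R :=
  rho + mu - expR (Num.max (x - y) 0) *
    (rho + mu - 1 + ski_atom y + ski_drift y * (expR (Num.min x y) - 1)).

Definition ski_survival (y x : R) : R :=
  Num.max (ski_greedy y x) (ski_floor y).

(** * Range and monotonicity of the survival function *)

Lemma ski_atom_ge0 y : 0 <= y -> 0 <= ski_atom y.
Proof.
move=> y0; rewrite /ski_atom; case: ifPn => y1; last by rewrite mulr_ge0.
by rewrite le_min mulr_ge0//= divr_ge0 ?mulr_ge0 ?subr_ge0// ltW.
Qed.

Lemma ski_drift_ge0 y : 0 <= ski_drift y.
Proof. by rewrite /ski_drift le_max lexx. Qed.

Lemma ski_atom_le y : ski_atom y <= mu * y.
Proof. by rewrite /ski_atom; case: ifP => // _; rewrite ge_min lexx. Qed.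

Lemma ski_atom_homo y y' : 0 <= y -> y <= y' -> ski_atom y <= ski_atom y'.
Proof.
move=> y0 yy'; have y'0 := le_trans y0 yy'; rewrite /ski_atom.
have Hmu : mu * y <= mu * y' by rewrite ler_wpM2l.
case: ifPn => [y1|]; case: ifPn => [y'1|] => //; last 2 first.
- by rewrite ge_min Hmu.
- by rewrite -leNgt => y1; move: y'1; rewrite ltNge (le_trans y1 yy').
rewrite le_min !ge_min Hmu /=; apply/orP; right.
apply: ler_pM; first by rewrite mulr_ge0 ?subr_ge0.
- by rewrite invr_ge0 subr_ge0 ltW.
- by rewrite ler_wpM2l ?subr_ge0.
- by rewrite lef_pV2 ?posrE ?subr_gt0// lerB.
Qed.

Lemma ski_drift_homo : {homo ski_drift : y y' / y <= y'}.
Proof.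
move=> y y' yy'; rewrite /ski_drift ge_max le_max lexx /= le_max.
have Hmu : mu * y <= mu * y' by rewrite ler_wpM2l.
by apply/orP; right; lra.
Qed.

Lemma ski_driftE y : 1 <= y -> ski_drift y = rho - 1 - mu * (1 - y).
Proof.
move=> y1; apply/max_idPr.
have : mu * (1 - y) <= 0 by rewrite mulr_ge0_le0// subr_le0.
by move: rho1; lra.
Qed.

Lemma ski_greedy_const_ge0 y x : 0 <= y -> 0 <= x ->
  0 <= rho + mu - 1 + ski_atom y + ski_drift y * (expR (Num.min x y) - 1).
Proof.
move=> y0 x0.
have := ski_atom_ge0 y0.
have : 0 <= ski_drift y * (expR (Num.min x y) - 1).
  by rewrite mulr_ge0 ?ski_drift_ge0// subr_ge0 -expR0 ler_expR le_min x0.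
by move: rho1 mu0; lra.
Qed.

(* Monotonicity in [s] of [ski_survival (tau / s) (t / s)] is the case
   [y = tau / s], [x = t / s] of the next two lemmas. *)
Lemma ski_greedy_homo y y' x x' : 0 <= y -> y <= y' -> 0 <= x -> x <= x' ->
  Num.max (x - y) 0 <= Num.max (x' - y') 0 ->
  ski_greedy y' x' <= ski_greedy y x.
Proof.
move=> y0 yy' x0 xx' Hm.
have y'0 := le_trans y0 yy'.
rewrite /ski_greedy lerD2l lerN2; apply: ler_pM.
- exact: expR_ge0.
- exact: ski_greedy_const_ge0.
- by rewrite ler_expR.
apply: lerD; first by rewrite lerD2l ski_atom_homo.
apply: ler_pM; rewrite ?ski_drift_ge0 ?ski_drift_homo//.
  by rewrite subr_ge0 -expR0 ler_expR le_min x0.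
by rewrite lerB// ler_expR le_min !ge_min xx' yy' orbT.
Qed.

Lemma ski_greedy_le y x : 0 <= y -> 0 <= x ->
  ski_greedy y x <= 1 - ski_atom y.
Proof.
move=> y0 x0; rewrite /ski_greedy.
have H := ski_greedy_const_ge0 y0 x0.
have : 1 <= expR (Num.max (x - y) 0) by rewrite -expR0 ler_expR le_max lexx
  orbT.
have : 0 <= ski_drift y * (expR (Num.min x y) - 1).
  by rewrite mulr_ge0 ?ski_drift_ge0// subr_ge0 -expR0 ler_expR le_min x0.
move: H; set a := (X in 0 <= X) => a0 b0 e1.
have : a <= expR (Num.max (x - y) 0) * a by rewrite ler_peMl.
by rewrite /a; lra.
Qed.

Lemma ski_floor_ge0 y : 0 <= y -> 0 <= ski_floor y.
Proof.
move=> y0; rewrite /ski_floor; case: ifPn => [y1|_]; last by rewrite le_max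
  lexx.
rewrite le_min mu0 subr_ge0 (le_trans (ski_atom_le y))//.
by apply: mulr_ile1 => //; exact: ltW.
Qed.

Lemma ski_floor_le_mu y : ski_floor y <= mu.
Proof.
rewrite /ski_floor; case: ifPn => [y1|_]; first by rewrite ge_min lexx.
by rewrite ge_max mu0 ge_min lexx.
Qed.

Lemma ski_floor_homo y y' : 0 <= y -> y <= y' -> ski_floor y' <= ski_floor y.
Proof.
move=> y0 yy'; have y'0 := le_trans y0 yy'.
have atom_homo := ski_atom_homo y0 yy'.
rewrite /ski_floor; case: ifPn => y'1.
  by rewrite (le_lt_trans yy' y'1) le_min !ge_min lexx /= lerB// orbT.
rewrite -leNgt in y'1.
case: ifPn => y1; last first.
  rewrite -leNgt in y1.
  rewrite ge_max le_max lexx /= le_max le_min !ge_min lexx /=.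
  apply/orP; right; apply/orP; right.
  rewrite lerB//; apply: ler_pM; rewrite ?ski_drift_ge0 ?expR_ge0//.
    exact: ski_drift_homo.
  by rewrite ler_expR lerB.
rewrite ge_max le_min mu0 /= le_min !ge_min lexx /=; apply/andP; split.
  rewrite subr_ge0 (le_trans (ski_atom_le y))//.
  by apply: mulr_ile1 => //; exact: ltW.
(* Across 1 the exponential is at least 1, so the unclipped floor at [y'] is at most
   [rho - mu - ski_drift y' = 1 - mu * y'], hence at most [1 - ski_atom y]. *)
apply/orP; right.
have : mu * y <= mu * y' by rewrite ler_wpM2l.
have := ski_atom_le y.
have : ski_drift y' <= ski_drift y' * expR (y' - 1).
  by rewrite ler_peMr ?ski_drift_ge0// -[leLHS]expR0 ler_expR subr_ge0.
by rewrite ski_driftE//; lra.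
Qed.

Lemma ski_survival_homo y y' x x' : 0 <= y -> y <= y' -> 0 <= x -> x <= x' ->
  Num.max (x - y) 0 <= Num.max (x' - y') 0 ->
  ski_survival y' x' <= ski_survival y x.
Proof.
move=> y0 yy' x0 xx' H; rewrite /ski_survival ge_max !le_max.
by rewrite ski_greedy_homo//= ski_floor_homo// orbT.
Qed.

Lemma ski_survival_noninc y x x' : 0 <= y -> 0 <= x -> x <= x' ->
  ski_survival y x' <= ski_survival y x.
Proof.
move=> y0 x0 xx'; apply: ski_survival_homo => //.
by rewrite ge_max !le_max lexx orbT andbT lerB.
Qed.

Lemma ski_survival_ge0 y x : 0 <= y -> 0 <= ski_survival y x.
Proof. by move=> y0; rewrite le_max ski_floor_ge0 ?orbT. Qed.

Lemma ski_survival_le1 y x : 0 <= y -> 0 <= x -> ski_survival y x <= 1.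
Proof.
move=> y0 x0; rewrite ge_max (le_trans (ski_floor_le_mu y) mu1) andbT.
have := ski_greedy_le y0 x0; have := ski_atom_ge0 y0; lra.
Qed.

Lemma ski_survival_scale tau t s s' : 0 <= tau -> 0 <= t -> 0 < s -> s <= s' ->
  ski_survival (tau / s) (t / s) <= ski_survival (tau / s') (t / s').
Proof.
move=> tau0 t0 s0 ss'; have s'0 := lt_le_trans s0 ss'.
have V : s'^-1 <= s^-1 by rewrite lef_pV2.
apply: ski_survival_homo; try by rewrite ?divr_ge0 ?ler_wpM2l// ltW.
rewrite -!mulrBl ge_max !le_max lexx orbT andbT.
have [h|/ltW h] := leP 0 (t - tau); first by rewrite ler_wpM2l.
by rewrite [X in _ || X]mulr_le0_ge0 ?orbT// invr_ge0 ltW.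
Qed.

Lemma continuous_ski_survival y : continuous (ski_survival y).
Proof.
move=> x.
have cexp (f : R -> R) : {for x, continuous f} ->
    {for x, continuous (fun x => expR (f x))}.
  by move=> cf; apply: continuous_comp => //; exact: continuous_expR.
have cmin : {for x, continuous (fun x => Num.min x y)}.
  by apply: (@continuous_min R R id (fun=> y)) => //; exact: cst_continuous.
have cmax : {for x, continuous (fun x => Num.max (x - y) 0)}.
  apply: (@continuous_max R R (fun x => x - y) (fun=> 0)).
    by apply: cvgB; [exact: cvg_id|exact: cvg_cst].
  exact: cst_continuous.
apply: (@continuous_max R R (ski_greedy y) (fun=> ski_floor y));
  last exact: cst_continuous.
rewrite /ski_greedy.
apply: cvgB; first exact: cvg_cst.
apply: cvgM; first exact: cexp.
apply: cvgD; first exact: cvg_cst.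
apply: cvgM; first exact: cvg_cst.
by apply: cvgB; [exact: cexp|exact: cvg_cst].
Qed.

(* The excess [kappa - g] may grow at most exponentially, so the buying cost
   of the excess is paid for by the rent it saves. *)
Lemma ski_cost_increment (g q : R -> R) (kappa x' x : R) : x' <= x ->
  (forall t, x' <= t <= x -> is_derive t 1 q (g t)) ->
  (forall t, x' <= t <= x -> expR (t - x) * (kappa - g x) <= kappa - g t) ->
  g x' - g x + (q x - q x') <= kappa * (x - x').
Proof.
move=> xx' dq H.
pose phi t := kappa * t - q t - (kappa - g x) * expR (t - x).
have : phi x' <= phi x.
  apply: (@is_derive_ge0_le _ _
    (fun t => kappa - g t - (kappa - g x) * expR (t - x))) => // t tx.
    have dqt := dq _ tx.
    rewrite /phi; apply: is_derive_eq.
    by rewrite /GRing.scale /=; ring.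
  by rewrite subr_ge0 mulrC H.
rewrite /phi subrr expR0.
have := H x'; rewrite lexx => /(_ xx'); rewrite [expR _ * _]mulrC.
lra.
Qed.

(** The excess below [kappa] of a maximum is the smaller of the two excesses; a constant nonnegative
    one satisfies the growth condition of [ski_cost_increment], and so does the minimum. *)
Lemma max_floor_growth (a : R -> R) (v kappa x t : R) : t <= x -> v <= kappa ->
  expR (t - x) * (kappa - a x) <= kappa - a t ->
  expR (t - x) * (kappa - Num.max (a x) v) <= kappa - Num.max (a t) v.
Proof.
move=> tx vk H.
have e0 := expR_ge0 (t - x).
have e1 : expR (t - x) <= 1 by rewrite -[leRHS]expR0 ler_expR subr_le0.
rewrite lerBrDr -lerBrDl ge_max; apply/andP; split; rewrite lerBrDl -lerBrDr.
  by rewrite (le_trans _ H)// ler_wpM2l// lerB// le_max lexx.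
apply: (@le_trans _ _ (expR (t - x) * (kappa - v))).
  by rewrite ler_wpM2l// lerB// le_max lexx orbT.
by rewrite ler_piMl// subr_ge0.
Qed.

Lemma ski_greedy_before y x : 0 <= x -> x <= y ->
  ski_greedy y x = 1 - ski_atom y + ski_drift y - ski_drift y * expR x.
Proof.
move=> x0 xy; rewrite /ski_greedy (min_idPl xy).
have /max_idPr -> : x - y <= 0 by rewrite subr_le0.
by rewrite expR0; ring.
Qed.

Lemma ski_greedy_after y x : 0 <= y -> y <= x ->
  ski_greedy y x = rho + mu - expR (x - y) * (rho + mu - ski_greedy y y).
Proof.
move=> y0 xy; rewrite (@ski_greedy_before y y)// /ski_greedy (min_idPr xy).
have /max_idPl -> : 0 <= x - y by rewrite subr_ge0.
by congr (_ - _ * _); ring.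
Qed.

Lemma ski_survival_flat y x z : 0 <= y -> 0 <= x -> x <= z ->
  ski_greedy y x <= ski_floor y -> ski_survival y z = ski_floor y.
Proof.
move=> y0 x0 xz H; apply/max_idPr; apply: le_trans H.
apply: ski_greedy_homo => //.
by rewrite ge_max !le_max lexx orbT andbT lerB.
Qed.

(** * Ski-rental cost against its budget *)

Section Cost.
Variables (y : R) (q : R -> R).
Hypotheses (y0 : 0 <= y) (q0 : q 0 = 0)
  (dq : forall x, 0 <= x -> is_derive x 1 q (ski_survival y x)).

Let c x := 1 - ski_survival y x + q x.

Let c_step kappa x' x : 0 <= x' -> x' <= x ->
  (forall t, x' <= t <= x ->
    expR (t - x) * (kappa - ski_survival y x) <= kappa - ski_survival y t) ->
  c x <= c x' + kappa * (x - x').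
Proof.
move=> x'0 xx' H.
have dq' t : x' <= t <= x -> is_derive t 1 q (ski_survival y t).
  by move=> /andP[x't _]; exact/dq/(le_trans x'0).
have := ski_cost_increment xx' dq' H; rewrite /c; lra.
Qed.

Let c_flat a x : 0 <= a -> a <= x -> ski_greedy y a <= ski_floor y ->
  c x <= c a + ski_floor y * (x - a).
Proof.
move=> a0 ax H; apply: c_step => // t /andP[at_ tx].
by rewrite !(ski_survival_flat y0 a0 _ H)// subrr mulr0.
Qed.

Let c_before kappa x' x : 0 <= x' -> x' <= x -> x <= y ->
  kappa = 1 - ski_atom y + ski_drift y -> ski_floor y <= kappa ->
  c x <= c x' + kappa * (x - x').
Proof.
move=> x'0 xx' xy -> fk; apply: c_step => // t /andP[x't tx].
have t0 := le_trans x'0 x't; have x0 := le_trans t0 tx.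
apply: max_floor_growth => //.
rewrite !ski_greedy_before// ?(le_trans tx)//.
rewrite !subKr mulrCA -expRD subrK; lra.
Qed.

Let c_after x' x : y <= x' -> x' <= x -> c x <= c x' + (rho + mu) * (x - x').
Proof.
move=> yx' xx'; apply: c_step => // [|t /andP[x't tx]].
  exact: le_trans yx'.
have yt := le_trans yx' x't; have yx := le_trans yt tx.
apply: max_floor_growth => //.
  by rewrite (le_trans (ski_floor_le_mu y))// lerDr (le_trans _ rho1).
rewrite (ski_greedy_after y0 yt) (ski_greedy_after y0 yx) !subKr mulrA -expRD.
by have -> : t - x + (x - y) = t - y by ring.
Qed.

Let c_homo x' x : 0 <= x' -> x' <= x -> c x' <= c x.
Proof.
move=> x'0 xx'; rewrite /c lerD//.
  by rewrite lerD2l lerN2 ski_survival_noninc.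
apply: (@is_derive_ge0_le _ q (ski_survival y)) => // t /andP[x't _].
  exact/dq/(le_trans x'0).
exact: ski_survival_ge0.
Qed.

Let c0 : c 0 <= ski_atom y.
Proof.
rewrite /c q0 addr0 lerBlDr -lerBlDl le_max ski_greedy_before//.
by rewrite expR0; apply/orP; left; lra.
Qed.

Let ski_atomE : y < 1 -> rho - 1 <= mu * (1 - y) ->
  ski_atom y * (1 - y) = (rho - 1) * y.
Proof.
move=> y1 H; rewrite /ski_atom y1; have d0 : 0 < 1 - y by rewrite subr_gt0.
have /min_idPr -> : (rho - 1) * y / (1 - y) <= mu * y.
  by rewrite ler_pdivrMr// mulrAC ler_wpM2r.
by rewrite divfK// gt_eqF.
Qed.

Let ski_atomE' : mu * (1 - y) < rho - 1 -> ski_atom y = mu * y.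
Proof.
move=> H; rewrite /ski_atom; case: ifPn => // y1.
have d0 : 0 < 1 - y by rewrite subr_gt0.
by apply/min_idPl; rewrite ler_pdivlMr// mulrAC ler_wpM2r// ltW.
Qed.

Let ski_cost_before x : y < 1 -> 0 <= x -> x <= y ->
  c x <= rho * x + mu * (y - x).
Proof.
move=> y1 x0 xy; have d0 : 0 < 1 - y by rewrite subr_gt0.
have [H|H] := leP (rho - 1) (mu * (1 - y)).
- have K0 : ski_drift y = 0 by apply/max_idPl; lra.
  have aE := ski_atomE y1 H.
  have fl : ski_floor y <= 1 - ski_atom y by rewrite /ski_floor y1 ge_min lexx
    orbT.
  have cx := @c_before (1 - ski_atom y) 0 x (lexx _) x0 xy _ fl.
  have {}cx := cx ltac:(by rewrite K0 addr0).
  (* The bound [a + (1 - a) * x] on the cost meets the budget line at [x = y], by the choice of the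
     atom [a], and its slope is at least [rho - mu], so it lies below the line earlier. *)
  have : 0 <= (1 - ski_atom y - rho + mu) * (y - x).
    rewrite mulr_ge0 ?subr_ge0// -(pmulr_lge0 _ d0).
    have -> : (1 - ski_atom y - rho + mu) * (1 - y) = mu * (1 - y) - (rho - 1).
      by rewrite !mulrDl mulNr aE; ring.
    by rewrite subr_ge0.
  have := c0; move: cx aE; rewrite subr0; nra.
- have K : ski_drift y = rho - 1 - mu * (1 - y) by apply/max_idPr; lra.
  have aE := ski_atomE' H.
  have fl : ski_floor y <= rho - mu.
    apply: (@le_trans _ _ (1 - ski_atom y)).
      by rewrite /ski_floor y1 ge_min lexx orbT.
    by rewrite aE; lra.
  have cx := @c_before (rho - mu) 0 x (lexx _) x0 xy _ fl.
  have {}cx := cx ltac:(by rewrite K aE; ring).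
  have := c0; move: cx; rewrite subr0 aE; lra.
Qed.

(* The two cases are where [mu] must dominate the two terms of [mu rho]. *)
Let ski_greedy1 : y < 1 -> ski_greedy y 1 <= ski_floor y.
Proof.
move=> y1; have d0 : 0 < 1 - y by rewrite subr_gt0.
rewrite /ski_floor y1 le_min ski_greedy_le// andbT.
rewrite (ski_greedy_after y0 (ltW y1)) ski_greedy_before//.
suff : rho * expR (- (1 - y)) <=
    rho + mu - (1 - ski_atom y + ski_drift y - ski_drift y * expR y).
  rewrite expRN ler_pdivrMr ?expR_gt0// mulrC; lra.
have [H|H] := leP (rho - 1) (mu * (1 - y)).
- have K0 : ski_drift y = 0 by apply/max_idPl; lra.
  have aE := ski_atomE y1 H.
  rewrite K0 -(ler_pM2r d0) mulrAC.
  apply: le_trans (tangent (ltW d0)) _.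
  by move: aE; lra.
- have K : ski_drift y = rho - 1 - mu * (1 - y) by apply/max_idPr; lra.
  rewrite ski_atomE'// K opprB expRD.
  have ey : expR y * expR (- y) = 1 by rewrite -expRD subrr expR0.
  have := median y0.
  rewrite -(ler_pM2r (expR_gt0 y)).
  move: ey; set a := expR y; set b := expR (- y); set e := expR (- 1).
  move=> ey; have -> : (rho * (1 - e) + mu * (y - 1 + 2 * b)) * a =
    rho * (1 - e) * a + mu * (y - 1) * a + 2 * mu * (a * b) by ring.
  rewrite ey; lra.
Qed.

(** Three stretches: the budget up to [y] is already handled; from [y] to 1 cost and budget both
    have slope [rho + mu]; from 1 on the survival is at its floor, whose rent is at most [mu] per
    unit of time. *)
Let ski_cost_lt1 x : y < 1 -> 0 <= x ->
  c x <= rho * Num.min x 1 + mu * `|y - x|.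
Proof.
move=> y1 x0; have [xy|/ltW yx] := leP x y.
  rewrite (min_idPl (le_trans xy (ltW y1))) ger0_norm ?subr_ge0//.
  exact: ski_cost_before.
have cy : c y <= rho * y.
  by have := ski_cost_before y1 y0 (lexx y); rewrite subrr mulr0 addr0.
rewrite ler0_norm ?subr_le0// opprB.
have [x1|/ltW x1] := leP x 1.
  have := c_after (lexx y) yx; lra.
have := c_after (lexx y) (ltW y1).
have := c_flat ler01 x1 (ski_greedy1 y1).
have : ski_floor y * (x - 1) <= mu * (x - 1).
  by rewrite ler_wpM2r ?subr_ge0// ski_floor_le_mu.
lra.
Qed.

(** Here the atom exhausts the whole mass: buying happens at once at cost 1. The budget is at least
    [mu * y] up to time 1, because [mu <= rho], and at least [rho] afterwards. *)
Let ski_cost_buy x : 1 <= y -> 1 <= mu * y -> 0 <= x ->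
  c x <= rho * Num.min x 1 + mu * `|y - x|.
Proof.
move=> y1 my1 x0.
have KE := ski_driftE y1.
have aE : ski_atom y = mu * y by rewrite /ski_atom ltNge y1.
have f0 : ski_floor y = 0.
  rewrite /ski_floor ltNge y1 /=; apply/max_idPl.
  rewrite ge_min; apply/orP; right.
  have : ski_drift y <= ski_drift y * expR (y - 1).
    by rewrite ler_peMr ?ski_drift_ge0// -[leLHS]expR0 ler_expR subr_ge0.
  by rewrite {1}KE; lra.
have g0 : ski_greedy y 0 <= ski_floor y.
  by rewrite f0 (le_trans (ski_greedy_le y0 _))// aE subr_le0.
have := c_flat (lexx _) x0 g0.
rewrite f0 mul0r addr0 {2}/c q0 addr0 (ski_survival_flat y0 _ _ g0)// f0.
move=> cx; apply: (le_trans cx).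
have [x1|/ltW x1] := leP x 1.
  rewrite ger0_norm; last by rewrite subr_ge0 (le_trans x1).
  have : 0 <= (rho - mu) * x by rewrite mulr_ge0// subr_ge0 (le_trans mu1).
  lra.
have : 0 <= mu * `|y - x| by rewrite mulr_ge0.
by move: rho1; lra.
Qed.

(** The cost follows the line until the time [a] at which the floor is met, then grows at the rate
    of the floor. The three cases are: floor 0, met by time [y - 1]; floor equal to the greedy value
    at [a = y - 1]; floor [mu], met between [y - 1] and 1. *)
Let ski_cost_at_prediction : 1 <= y -> mu * y < 1 -> c y <= rho.
Proof.
move=> y1 my1.
set K := ski_drift y.
have KE : K = rho - 1 - mu * (1 - y) by exact: ski_driftE.
have K0 : 0 <= K by exact: ski_drift_ge0.
have aE : ski_atom y = mu * y by rewrite /ski_atom ltNge y1.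
have d0 : 0 <= y - 1 by rewrite subr_ge0.
have Ke : K <= K * expR (y - 1).
  by rewrite ler_peMr// -[leLHS]expR0 ler_expR.
have kE : rho - mu = 1 - ski_atom y + ski_drift y by rewrite aE -/K KE; ring.
have md : 0 <= mu * (y - 1) by rewrite mulr_ge0.
have fE : ski_floor y = Num.max 0 (Num.min mu (rho - mu - K * expR (y - 1))).
  by rewrite /ski_floor ltNge y1.
have fk : ski_floor y <= rho - mu.
  by rewrite fE ge_max ge_min; apply/andP; split; [|apply/orP; right]; lra.
have stop a v : 0 <= a -> a <= y -> ski_floor y = v ->
    K * expR a = rho - mu - v -> mu * y + (rho - mu) * a + v * (y - a) <= rho ->
    c y <= rho.
  move=> a0 ay fv Ka H.
  have ga : ski_greedy y a <= ski_floor y.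
    by rewrite ski_greedy_before// -kE -/K Ka fv; lra.
  have := c_flat a0 ay ga.
  have := c_before (lexx 0) a0 ay kE fk.
  have := c0; rewrite aE fv; lra.
have stop_time w : K <= w -> 0 < K -> exists2 a, 0 <= a & expR a = w / K.
  move=> Kw K_gt0; exists (ln (w / K)); last first.
    by rewrite lnK// posrE divr_gt0// (lt_le_trans K_gt0).
  by rewrite ln_ge0// ler_pdivlMr// mul1r.
have Kpos w : 0 < w -> w <= K * expR (y - 1) -> 0 < K.
  move=> w0 wK; rewrite lt_neqAle K0 andbT; apply/eqP => K00.
  by move: wK; rewrite -K00 mul0r leNgt w0.
have tan a : 0 <= a -> rho * a <= (rho - 1 + mu * a) * expR a.
  by move=> a0; have := tangent a0; rewrite expRN ler_pdivrMr ?expR_gt0.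
have [wK|Kw] := leP (rho - mu) (K * expR (y - 1)).
  have w0 : 0 < rho - mu by lra.
  have K_gt0 := Kpos _ w0 wK.
  have [|a a0 ea] := @stop_time (rho - mu) _ K_gt0; first by lra.
  have Ka : K * expR a = rho - mu by rewrite ea mulrC divfK// gt_eqF.
  have ay : a <= y - 1.
    by rewrite -ler_expR -(ler_pM2l K_gt0) Ka.
  apply: (stop a 0) => //; [lra| |by rewrite subr0|].
    by rewrite fE; apply/max_idPl; rewrite ge_min; apply/orP; right; lra.
  have := tan _ a0.
  have -> : (rho - 1 + mu * a) * expR a = K * expR a - mu * (y - 1 - a) * expR
    a.
    by rewrite KE; ring.
  rewrite Ka.
  have : mu * (y - 1 - a) <= mu * (y - 1 - a) * expR a.
    rewrite ler_peMr ?mulr_ge0 ?subr_ge0// -[leLHS]expR0 ler_expR//.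
  lra.
have [wK|Kw'] := leP (rho - mu - K * expR (y - 1)) mu.
  apply: (stop (y - 1) (rho - mu - K * expR (y - 1))) => //; [lra| |lra|].
    by rewrite fE (min_idPr wK); apply/max_idPr; lra.
  have := tan _ d0; rewrite KE; lra.
have wpos : 0 < rho - 2 * mu.
  by have := mulr_ge0 K0 (expR_ge0 (y - 1)); lra.
have med : (rho - 2 * mu) * expR (- 1) <= rho - 1.
  by have := median ler01; lra.
have K_gt0 : 0 < K.
  rewrite KE; have := mulr_gt0 wpos (expR_gt0 (- 1)); lra.
have [|a a0 ea] := @stop_time (rho - 2 * mu) _ K_gt0; first by lra.
have Ka : K * expR a = rho - 2 * mu by rewrite ea mulrC divfK// gt_eqF.
have ya : y - 1 <= a.
  by rewrite -ler_expR -(ler_pM2l K_gt0) Ka; lra.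
have Kem : K = (rho - 2 * mu) * expR (- a).
  by rewrite -Ka -mulrA -expRD subrr expR0 mulr1.
have a1 : a <= 1.
  suff : expR (- 1) <= expR (- a) by rewrite ler_expR lerN2.
  rewrite -(ler_pM2l wpos) -Kem KE; lra.
apply: (stop a mu) => //; [lra| |lra|].
  by rewrite fE (min_idPl (ltW Kw')); apply/max_idPr.
suff : 2 * mu * (y - 1) <= (rho - 2 * mu) * (1 - a) by lra.
(* For [expR a <= 2] the tangent condition at [a] suffices. Otherwise [mu * (y - 1) = K - (rho - 1)]
   is at most [(rho - 2 * mu) * (expR (- a) - expR (- 1))], and the tangent of the exponential
   bounds the difference by [(1 - a) / 2]. *)
have [e2|e2] := leP (expR a) 2.
  have := tan _ a0.
  have -> : (rho - 1 + mu * a) * expR a = K * expR a + mu * (a - (y - 1)) *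
    expR a.
    by rewrite KE; ring.
  rewrite Ka.
  have : mu * (a - (y - 1)) * expR a <= mu * (a - (y - 1)) * 2.
    by rewrite ler_wpM2l// mulr_ge0// subr_ge0.
  lra.
have e2' : expR (- a) <= 2^-1.
  by rewrite expRN lef_pV2 ?posrE ?expR_gt0// ltW.
have e3 : expR (- a) - expR (- 1) <= expR (- a) * (1 - a).
  have -> : expR (- 1) = expR (- a) * expR (a - 1) by rewrite -expRD; congr
    expR; ring.
  have := expR_ge1Dx (a - 1) => h.
  have : expR (- a) * (1 + (a - 1)) <= expR (- a) * expR (a - 1).
    by rewrite ler_wpM2l ?expR_ge0.
  lra.
have e4 : expR (- a) * (1 - a) <= 2^-1 * (1 - a).
  by rewrite ler_wpM2r ?subr_ge0.
have e5 : (rho - 2 * mu) * (expR (- a) - expR (- 1)) <=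
          (rho - 2 * mu) * (2^-1 * (1 - a)).
  by rewrite ler_pM2l// (le_trans e3).
move: Kem KE; lra.
Qed.

Lemma ski_survival_cost x : 0 <= x ->
  1 - ski_survival y x + q x <= rho * Num.min x 1 + mu * `|y - x|.
Proof.
move=> x0; rewrite -/(c x).
have [y1|y1] := ltP y 1; first exact: ski_cost_lt1.
have [my1|my1] := leP 1 (mu * y); first exact: ski_cost_buy.
have cy := ski_cost_at_prediction y1 my1.
have [yx|/ltW xy] := leP y x.
  rewrite (min_idPr (le_trans y1 yx)) ler0_norm ?subr_le0// mulr1 opprB.
  have gy : ski_greedy y y <= ski_floor y.
    rewrite /ski_floor ltNge y1 /= le_max le_min; apply/orP; right.
    rewrite ski_greedy_before// /ski_atom ltNge y1 /=.
    have h : expR (y - 1) <= expR y by rewrite ler_expR; lra.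
    have {}h : ski_drift y * expR (y - 1) <= ski_drift y * expR y.
      by rewrite ler_wpM2l ?ski_drift_ge0.
    apply/andP; split; last by rewrite {1}ski_driftE//; lra.
    have med : rho - 2 * mu <= (rho - 1) * expR 1.
      have := median ler01; rewrite -(ler_pM2r (expR_gt0 1)).
      have : expR (- 1) * expR 1 = 1 :> R by rewrite -expRD addNr expR0.
      set e := expR 1; set f := expR _ => fe.
      have -> : (rho * (1 - f) + mu * (1 - 1 + 2 * f)) * e =
        rho * e - (rho - 2 * mu) * (f * e) by ring.
      rewrite fe; lra.
    have : (rho - 1) * expR 1 <= ski_drift y * expR y.
      apply: ler_pM; rewrite ?expR_ge0 ?subr_ge0 ?ler_expR//.
      have : 0 <= mu * (y - 1) by rewrite mulr_ge0 ?subr_ge0.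
      by rewrite ski_driftE//; lra.
    by have := ski_driftE y1; lra.
  have := c_flat y0 yx gy.
  have : ski_floor y * (x - y) <= mu * (x - y).
    by rewrite ler_wpM2r ?subr_ge0// ski_floor_le_mu.
  lra.
rewrite ger0_norm ?subr_ge0//.
have [x1|/ltW x1] := leP x 1.
  have aE : ski_atom y = mu * y by rewrite /ski_atom ltNge y1.
  have kE : rho - mu = 1 - ski_atom y + ski_drift y.
    by rewrite aE ski_driftE//; ring.
  have fk : ski_floor y <= rho - mu.
    rewrite /ski_floor ltNge y1 /= ge_max ge_min.
    have := mulr_ge0 (ski_drift_ge0 y) (expR_ge0 (y - 1)).
    by move: rho1 mu1 => ? ? ?; apply/andP; split; [|apply/orP; right]; lra.
  have := c_before (lexx 0) x0 xy kE fk; rewrite subr0.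
  have := c0; rewrite aE; lra.
(* Between 1 and [y] the budget is at least [rho], so monotonicity carries the bound at [y] back to
   [x]. *)
have := c_homo x0 xy.
have : 0 <= mu * (y - x) by rewrite mulr_ge0 ?subr_ge0.
lra.
Qed.

End Cost.

End SkiRental.

(** * Primitives of continuous functions and threshold sums *)

Lemma continuous_primitive (R : realType) (g : R -> R) : continuous g ->
  exists P : R -> R, [/\ P 0 = 0,
    forall x : R, 0 <= x -> is_derive x 1 P (g x) &
    forall l : R, 0 <= l ->
      (\int[@lebesgue_measure R]_(t in `[0%R, l]) (g t)%:E = (P l)%:E)%E].
Proof.
move=> cg.
(* Starting at [-1] makes 0 an interior point, so that the derivative at 0 is two-sided. *)
pose F x := (\int[@lebesgue_measure R]_(t in `[(- 1)%R, x]) g t)%R.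
pose P x := F x - F 0.
have dP (x : R) : 0 <= x -> is_derive x 1 P (g x).
  move=> x0; have ab : x < x + 1 by rewrite ltrDl.
  have ig : lebesgue_measure.-integrable `[(- 1)%R, x + 1] (EFin \o g).
    apply: continuous_compact_integrable; first exact: segment_compact.
    exact: continuous_subspaceT.
  have x1 : - 1 < x by rewrite (lt_le_trans _ x0)// oppr_lt0.
  have [dF F'] := continuous_FTC1_closed ab ig x1 (cg x).
  have dFx : is_derive x 1 F (g x).
    by apply: DeriveDef => //; rewrite -derive1E.
  by rewrite /P; apply: is_derive_eq; rewrite subr0.
have P0 : P 0 = 0 by rewrite /P subrr.
exists P; split => // l; rewrite le_eqVlt => /predU1P[<-|l0].
  by rewrite set_itv1 integral_set1 P0.
have cP (x : R) : 0 <= x -> {for x, continuous P}.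
  move=> /dP dPx; apply/differentiable_continuous/derivable1_diffP.
  exact: ex_derive.
rewrite (@continuous_FTC2 _ g P 0 l l0) ?P0 ?sube0//.
- exact: continuous_subspaceT.
- split.
  + move=> x; rewrite in_itv /= => /andP[/ltW /dP dPx _]; exact: ex_derive.
  + exact/cvg_at_right_filter/cP.
  + exact/cvg_at_left_filter/cP/ltW.
- move=> x; rewrite in_itv /= => /andP[/ltW /dP dPx _].
  by rewrite derive1E derive_val.
Qed.

Lemma measurable_fun_nat_of_bool (R : realType) (d : measure_display)
    (T : measurableType d) (b : T -> bool) :
  measurable_fun setT b -> measurable_fun setT (fun x => (b x)%:R : R).
Proof.
move=> mb.
have -> : (fun x => (b x)%:R : R) = (fun x => if b x then 1 else 0).
  by apply/funext => x; case: (b x).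
exact: measurable_fun_ifT.
Qed.

(** The indices where [b] holds form an initial segment, so their number is the index at which the
    telescoping sum stops. *)
Lemma telescope_threshold (V : zmodType) (f : nat -> V) (b : nat -> bool) m :
  (forall i j, (i <= j < m)%N -> b j -> b i) ->
  f (\sum_(j < m) b j)%N = f 0%N + \sum_(j < m) (f j.+1 - f j) *+ b j.
Proof.
elim: m => [|m IH] bP; first by rewrite !big_ord0 addr0.
rewrite !big_ord_recr /=; case: (boolP (b m)) => bm /=.
  have bT (i : 'I_m) : b i.
    by apply: (bP i m) => //; rewrite ltnW//= ltnS.
  rewrite (eq_bigr (fun=> 1%N)) => [|i _]; last by rewrite bT.
  rewrite sum1_card card_ord addn1.
  rewrite (eq_bigr (fun i : 'I_m => f i.+1 - f i)) => [|i _]; last by rewrite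
    bT.
  rewrite -(big_mkord xpredT (fun i => f i.+1 - f i)) telescope_sumr//.
  by rewrite mulr1n addrCA addrA subrK addrC subrK.
rewrite addn0 mulr0n addr0 IH// => i j /andP[ij jm].
by apply: bP; rewrite ij/= ltnW.
Qed.

(** * Randomized schedules *)

Section Schedules.
Variables (R : realType) (D : dpm_system R).
Local Notation leb := (@lebesgue_measure R).
Local Notation state := 'I_(nb_sleep D).+1.

Lemma alpha_nonneg (i : state) : 0 <= alpha D i.
Proof.
apply: le_trans (alpha_ge0 D) _.
have := ltn_ord i; rewrite ltnS leq_eqVlt => /orP[/eqP ik|ik].
  by have -> : i = ord_max by exact: val_inj.
by apply/ltW/alpha_decr.
Qed.

Lemma alpha_homo (i j : state) : (i <= j)%N -> alpha D j <= alpha D i.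
Proof.
rewrite leq_eqVlt => /orP[/eqP ij|ij]; last exact/ltW/alpha_decr.
by have -> : i = j by exact: val_inj.
Qed.

Lemma beta_homo (i j : state) : (i <= j)%N -> beta D i <= beta D j.
Proof.
rewrite leq_eqVlt => /orP[/eqP ij|ij]; last exact/ltW/beta_incr.
by have -> : i = j by exact: val_inj.
Qed.

(** A monotone schedule occupies each state during an interval. *)
Lemma measurable_state (s : schedule D) (l : R) (i : state) :
  measurable [set t : R | 0 <= t <= l /\ s t = i].
Proof.
apply: is_interval_measurable => x y /= [/andP[x0 xl] sx] [/andP[y0 yl] sy] z.
move=> /andP[xz zy]; have z0 := le_trans x0 xz.
split; first by rewrite z0 (le_trans zy yl).
apply/val_inj/eqP; rewrite eqn_leq -{1}sy -sx.
by rewrite !(state_at_homo s).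
Qed.

Lemma alpha_stateE (s : schedule D) (l t : R) : 0 <= t <= l ->
  alpha D (s t) =
  \sum_(i : state) alpha D i * \1_[set t : R | 0 <= t <= l /\ s t = i] t.
Proof.
move=> tl; rewrite (bigD1 (s t))//= big1 ?addr0 => [|i its].
  by rewrite indicE mem_set// mulr1.
rewrite indicE memNset ?mulr0// => -[_ sti].
by move: its; rewrite sti eqxx.
Qed.

Lemma measurable_alpha_state (s : schedule D) (l : R) :
  measurable_fun `[0, l] (fun t => alpha D (s t)).
Proof.
apply: (@eq_measurable_fun _ _ _ _ _ (fun t => \sum_(i <- enum state)
    alpha D i * \1_[set t : R | 0 <= t <= l /\ s t = i] t)).
  move=> t /set_mem /=; rewrite in_itv /= => tl.
  by rewrite (alpha_stateE s tl) big_enum.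
apply: measurable_sum => i; apply: measurable_funM => //.
by apply: measurable_indic; exact: measurable_state.
Qed.

Lemma residence_cost (s : schedule D) (l : R) : 0 <= l ->
  ((\sum_(i : state) residence_time s l i * alpha D i)%:E =
   \int[leb]_(t in `[0%R, l]) (alpha D (s t))%:E)%E.
Proof.
move=> l0.
pose A i := [set t : R | 0 <= t <= l /\ s t = i].
have -> : (\int[leb]_(t in `[0%R, l]) (alpha D (s t))%:E =
   \int[leb]_(t in `[0%R, l]) (\sum_(i <- enum state) (alpha D i)%:E * (\1_(A
     i) t)%:E))%E.
  apply: eq_integral => t /set_mem /=; rewrite in_itv /= => tl.
  by rewrite big_enum /= (alpha_stateE s tl) -sumEFin.
rewrite ge0_integral_sum//; last 2 first.
- move=> i; apply/measurable_EFinP/measurable_funM => //.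
  by apply: measurable_indic; exact: measurable_state.
- by move=> i t _; rewrite -EFinM lee_fin mulr_ge0 ?alpha_nonneg.
rewrite big_enum /= -sumEFin; apply: eq_bigr => i _.
rewrite ge0_integralZl_EFin ?alpha_nonneg//; last first.
  by apply/measurable_EFinP/measurable_indic; exact: measurable_state.
rewrite integral_indic//; last exact: measurable_state.
have AI : A i `&` `[0, l] = A i.
  by apply/setIidPl => t /= [tl _]; rewrite in_itv.
rewrite AI EFinM muleC /residence_time fineK//.
rewrite ge0_fin_numE// (@le_lt_trans _ _ (leb `[0%R, l]))//.
  by rewrite le_measure ?inE//; [exact: measurable_state|move=> t [tl _] /=;
    rewrite in_itv].
by rewrite lebesgue_measure_itv /=; case: ifP => _; rewrite ?ltry// -EFinB ltry.
Qed.

Lemma period_cost_ge0 (s : schedule D) (l : R) : 0 <= l -> 0 <= period_cost s l.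
Proof.
move=> l0; rewrite /period_cost addr_ge0//; last by rewrite -(beta0 D)
  beta_homo.
by apply: sumr_ge0 => i _; rewrite mulr_ge0 ?alpha_nonneg ?fine_ge0.
Qed.

(** The last state has the lowest power met during the period. Offline, it is therefore enough to
    compare with one fixed state per period. *)
Lemma period_cost_ge (s : schedule D) (l : R) : 0 <= l ->
  alpha D (s l) * l + beta D (s l) <= period_cost s l.
Proof.
move=> l0; rewrite lerD2r -lee_fin residence_cost//.
have -> : (alpha D (s l) * l)%:E = (\int[leb]_(t in `[0%R, l]) (alpha D (s
  l))%:E)%E.
  rewrite integral_cst//= lebesgue_measure_itv /= lte_fin EFinM.
  by case: ltgtP l0 => // [_ _|<- _]; rewrite ?mule0// -EFinB subr0.
apply: ge0_le_integral => //.
- by move=> t _; rewrite lee_fin alpha_nonneg.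
- by apply/measurable_EFinP; exact: measurable_alpha_state.
- move=> t /=; rewrite in_itv /= => /andP[t0 tl].
  by rewrite lee_fin alpha_homo// (state_at_homo s).
Qed.

(** * Schedules on a chain, driven by one uniform seed *)

Section Layered.
Variables (m : nat) (c : nat -> state).
Hypotheses (c0 : c 0%N = ord0) (cm : c m = ord_max)
  (cS : forall j, (j < m)%N -> (c j < c j.+1)%N).

Lemma chain_homo i j : (i <= j <= m)%N -> (c i <= c j)%N.
Proof.
elim: j => [|j IH]; first by rewrite leqn0 => /andP[/eqP ->].
rewrite leq_eqVlt => /andP[/orP[/eqP ->//|ij] jm].
by rewrite (leq_trans (IH _))// ?(ltnW (cS jm))//; rewrite -ltnS ij ltnW.
Qed.

Definition chain_rate j : R := alpha D (c j) - alpha D (c j.+1).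
Definition chain_price j : R := beta D (c j.+1) - beta D (c j).

Lemma chain_rate_gt0 j : (j < m)%N -> 0 < chain_rate j.
Proof. by move=> jm; rewrite subr_gt0 alpha_decr// cS. Qed.

Lemma chain_price_gt0 j : (j < m)%N -> 0 < chain_price j.
Proof. by move=> jm; rewrite subr_gt0 beta_incr// cS. Qed.

Variable G : nat -> R -> R.
Hypotheses
  (G_cont : forall j, (j < m)%N -> continuous (G j))
  (G_ge0 : forall j (t : R), (j < m)%N -> 0 <= t -> 0 <= G j t)
  (G_le1 : forall j (t : R), (j < m)%N -> 0 <= t -> G j t <= 1)
  (G_noninc : forall j (t t' : R), (j < m)%N -> 0 <= t -> t <= t' ->
    G j t' <= G j t)
  (G_layer : forall i j (t : R), (i <= j < m)%N -> 0 <= t -> G i t <= G j t).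

(* With the seed [u] uniform on [0, 1], layer [j] has been left by time [t]
   with probability [1 - G j t]. *)
Definition layer_count (u t : R) : nat := \sum_(j < m) (G j t < u)%R.

(** The value at time 0 is forced by [state_at0], although [G j 0] may be below 1: an atom at 0
    becomes an immediate move. *)
Definition layered_state (u t : R) : state :=
  if t <= 0 then ord0 else c (layer_count u t).

Lemma layer_count_le u t : (layer_count u t <= m)%N.
Proof.
rewrite -[leqRHS]card_ord -sum1_card leq_sum// => i _.
by case: (_ < _).
Qed.

Lemma layered_state0 u : layered_state u 0 = ord0.
Proof. by rewrite /layered_state lexx. Qed.

Lemma layered_state_homo u (t t' : R) : 0 <= t -> t <= t' ->
  (layered_state u t <= layered_state u t')%N.
Proof.
move=> t0 tt'; rewrite /layered_state; case: ifPn => //; rewrite -ltNge =>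
  t_gt0.
rewrite leNgt (lt_le_trans t_gt0 tt') /= chain_homo// layer_count_le andbT.
apply: leq_sum => j _; have := @G_noninc j t t' (ltn_ord j) t0 tt'.
by case: ltP => // h h'; rewrite (le_lt_trans h' h).
Qed.

Definition layered_schedule (u : R) : schedule D :=
  Schedule (layered_state0 u) (@layered_state_homo u).

Let antitone (u t : R) : 0 <= t -> forall i j, (i <= j < m)%N ->
  (G j t < u) -> (G i t < u).
Proof. by move=> t0 i j ij; apply: le_lt_trans; exact: G_layer. Qed.

Let alpha_layered (u t : R) : 0 < t -> alpha D (layered_state u t) =
  alpha D ord_max + \sum_(j < m) chain_rate j * (u <= G j t)%R%:R.
Proof.
move=> t0; rewrite /layered_state leNgt t0 /= /layer_count.
rewrite (telescope_threshold (fun j => alpha D (c j)) (@antitone u t (ltW t0))).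
have -> : alpha D ord_max = alpha D (c 0%N) - \sum_(j < m) chain_rate j.
  rewrite -cm -(big_mkord xpredT chain_rate) /chain_rate.
  rewrite (telescope_sumr_eq (fun j => - alpha D (c j))) => [|//|j _]; last
    first.
    by rewrite opprK addrC.
  by ring.
rewrite -addrA; congr (_ + _); rewrite -sumrN -big_split /=.
apply: eq_bigr => j _; rewrite /chain_rate leNgt.
by case: (_ < _); rewrite /= ?mulr1n ?mulr0n ?mulr0 ?mulr1; ring.
Qed.

Let beta_layered (u t : R) : 0 < t -> beta D (layered_state u t) =
  \sum_(j < m) chain_price j * (G j t < u)%R%:R.
Proof.
move=> t0; rewrite /layered_state leNgt t0 /= /layer_count.
rewrite (telescope_threshold (fun j => beta D (c j)) (@antitone u t (ltW t0))).
rewrite c0 beta0 add0r; apply: eq_bigr => j _.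
by rewrite mulr_natr.
Qed.

Let P : probability _ R := uniform_prob (@ltr01 R).

Let P_le (g : R) : 0 <= g -> g <= 1 ->
  (\int[P]_u ((u <= g)%R%:R)%:E = g%:E)%E.
Proof.
move=> g0 g1; rewrite /P integral_uniform; last 2 first.
- apply/measurable_EFinP/measurable_fun_nat_of_bool.
  by apply: measurable_fun_ler => //; exact: measurable_cst.
- by move=> x; rewrite lee_fin.
rewrite subr0 invr1 mul1e.
have -> : (\int[leb]_(u in `[0%R, 1%R]) ((u <= g)%R%:R)%:E =
           \int[leb]_(u in `[0%R, 1%R]) (\1_`[0%R, g] u)%:E)%E.
  apply: eq_integral => u /set_mem /=; rewrite in_itv /= => /andP[u0 _].
  by rewrite indicE mem_setE in_itv /= u0.
rewrite integral_indic//.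
have -> : `[0%R, g]%classic `&` `[0%R, 1%R]%classic = `[0%R, g]%classic.
  apply/setIidPl => u /=; rewrite !in_itv /= => /andP[-> ug].
  exact: le_trans g1.
rewrite /= lebesgue_measure_itv /= lte_fin.
by case: ltgtP g0 => // [_ _|<- _] //; rewrite -EFinB subr0.
Qed.

Variable Q : nat -> R -> R.
Hypothesis QP : forall j (l : R), (j < m)%N -> 0 <= l ->
  (\int[leb]_(t in `[0%R, l]) (G j t)%:E = (Q j l)%:E)%E.

Section Length.
Variable l : R.
Hypothesis l_gt0 : 0 < l.

(** Power drawn at time [z.2] under seed [z.1], as a single function on the product so that Tonelli
    applies. Time 0 is cut off, since [alpha_layered] needs a positive time. *)
Let h (z : R * R) : R :=
  (alpha D ord_max + \sum_(j < m) chain_rate j * (z.1 <= G j z.2)%R%:R) *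
  \1_`]0, l] z.2.

Let h_ge0 z : 0 <= h z.
Proof.
rewrite /h mulr_ge0// addr_ge0 ?alpha_nonneg// sumr_ge0// => j _.
by rewrite mulr_ge0// ltW// chain_rate_gt0.
Qed.

Let measurable_h : measurable_fun setT h.
Proof.
apply: measurable_funM; last first.
  apply: (measurableT_comp _ measurable_snd).
  exact: measurable_indic.
apply: measurable_funD => //.
have -> : (fun x : R * R => \sum_(j < m) chain_rate j * (x.1 <= G j x.2)%R%:R) =
    (fun x : R * R => \sum_(j <- enum 'I_m) chain_rate j * (x.1 <= G j
      x.2)%R%:R).
  by apply/funext => x; rewrite big_enum.
apply: measurable_sum => j; apply: measurable_funM => //.
apply: measurable_fun_nat_of_bool; apply: measurable_fun_ler => //.
apply: (measurableT_comp _ measurable_snd).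
by apply: continuous_measurable_fun; exact: G_cont.
Qed.

Let residence_layered (u : R) :
  ((\sum_(i : state) residence_time (layered_schedule u) l i * alpha D i)%:E =
   \int[leb]_t (h (u, t))%:E)%E.
Proof.
rewrite residence_cost ?ltW// -integral_itv_obnd_cbnd; last first.
  apply/measurable_EFinP; apply: (@measurable_funS _ _ _ _ `[0%R, l]%classic)
    => //.
    exact: subset_itv_oc_cc.
  exact: measurable_alpha_state.
rewrite integral_mkcond; apply: eq_integral => t _.
rewrite patchE /h /= indicE; case: ifPn => tl; last by rewrite mulr0.
move: tl; rewrite inE /= in_itv /= => /andP[t0 _].
by rewrite alpha_layered// mulr1.
Qed.

Lemma measurable_layered_cost :
  measurable_fun setT (fun u : R => period_cost (layered_schedule u) l).
Proof.
apply: measurable_funD.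
  apply/measurable_EFinP.
  have -> : EFin \o (fun u : R => \sum_(i : state)
      residence_time (layered_schedule u) l i * alpha D i) =
      fubini_F leb (EFin \o h).
    by apply/funext => u /=; rewrite residence_layered.
  apply: measurable_fun_fubini_tonelli_F; first exact/measurable_EFinP.
  by move=> z; rewrite lee_fin.
have -> : (fun u : R => beta D (layered_schedule u l)) =
    (fun u => \sum_(j <- enum 'I_m) chain_price j * (G j l < u)%R%:R).
  by apply/funext => u; rewrite beta_layered// big_enum.
apply: measurable_sum => j; apply: measurable_funM => //.
apply: measurable_fun_nat_of_bool; apply: measurable_fun_ltr => //.
Qed.

Let integral_h (t : R) : (\int[P]_u (h (u, t))%:E =
  ((fun t => (alpha D ord_max + \sum_(j < m) chain_rate j * G j t)%:E)
    \_ `]0%R, l]) t)%E.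
Proof.
rewrite patchE; case: ifPn => tl; last first.
  rewrite /h /= integral0_eq// => u _.
  by rewrite indicE (negbTE tl) mulr0.
have : 0 <= t by move: tl; rewrite inE /= in_itv /= => /andP[/ltW].
move=> t0.
have -> : (\int[P]_u (h (u, t))%:E = \int[P]_u ((alpha D ord_max)%:E +
    \sum_(j <- enum 'I_m) (chain_rate j)%:E * ((u <= G j t)%R%:R)%:E))%E.
  apply: eq_integral => u _; rewrite /h /= indicE tl mulr1 EFinD; congr (_ +
    _)%E.
  by rewrite big_enum /= -sumEFin.
have mle (j : 'I_m) : measurable_fun [set: measurableTypeR R]
    (fun u : measurableTypeR R => ((u <= G j t)%R%:R)%:E : \bar R).
  apply/measurable_EFinP/measurable_fun_nat_of_bool.
  by apply: measurable_fun_ler => //; exact: measurable_cst.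
have mrle (j : 'I_m) : measurable_fun [set: measurableTypeR R]
    (fun u : measurableTypeR R => (chain_rate j)%:E * ((u <= G j t)%R%:R)%:E)%E.
  by apply: emeasurable_funM => //; exact: mle.
have r0 (j : 'I_m) : 0 <= chain_rate j by apply/ltW/chain_rate_gt0.
rewrite ge0_integralD//; last 3 first.
- by move=> u _; rewrite lee_fin alpha_nonneg.
- by move=> u _; apply: sume_ge0 => j _; rewrite mule_ge0// lee_fin.
- exact: emeasurable_sum.
rewrite integral_cst//= probability_setT mule1.
rewrite ge0_integral_sum//; last first.
  by move=> j u _; rewrite mule_ge0// lee_fin.
rewrite big_enum /= EFinD -sumEFin; congr (_ + _)%E.
apply: eq_bigr => j _; rewrite ge0_integralZl_EFin//.
by rewrite P_le ?G_ge0 ?G_le1// EFinM.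
Qed.

Let expected_residence : (\int[P]_u \int[leb]_t (h (u, t))%:E =
  (alpha D ord_max * l + \sum_(j < m) chain_rate j * Q j l)%:E)%E.
Proof.
have r0 (j : 'I_m) : 0 <= chain_rate j by apply/ltW/chain_rate_gt0.
have mG (j : 'I_m) : measurable_fun setT (G j).
  by apply: continuous_measurable_fun; exact: G_cont.
transitivity (\int[leb]_t \int[P]_u (h (u, t))%:E)%E.
  apply: (@fubini_tonelli _ _ _ _ R P leb (EFin \o h)).
    exact/measurable_EFinP.
  by move=> z; rewrite lee_fin.
under eq_integral do rewrite /= integral_h.
rewrite -integral_mkcond integral_itv_obnd_cbnd; last first.
  apply/measurable_EFinP/measurable_funTS/measurable_funD => //.
  have -> : (fun x : R => \sum_(j < m) chain_rate j * G j x) =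
      (fun x : R => \sum_(j <- enum 'I_m) chain_rate j * G j x).
    by apply/funext => x; rewrite big_enum.
  by apply: measurable_sum => j; exact: measurable_funM.
have -> : (\int[leb]_(t in `[0%R, l])
      (alpha D ord_max + \sum_(j < m) chain_rate j * G j t)%:E =
    \int[leb]_(t in `[0%R, l]) ((alpha D ord_max)%:E +
    \sum_(j <- enum 'I_m) (chain_rate j)%:E * (G j t)%:E))%E.
  by apply: eq_integral => t _; rewrite EFinD big_enum /= -sumEFin.
have mrG (j : 'I_m) : measurable_fun `[0%R, l]
    (fun t : R => (chain_rate j)%:E * (G j t)%:E)%E.
  by apply/measurable_funTS/emeasurable_funM => //; exact/measurable_EFinP.
have rG0 (j : 'I_m) (t : R) : `[0%R, l]%classic t ->
    (0 <= (chain_rate j)%:E * (G j t)%:E)%E.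
  rewrite /= in_itv /= => /andP[t0 _].
  by rewrite mule_ge0// lee_fin// G_ge0.
rewrite ge0_integralD//; last 3 first.
- by move=> u _; rewrite lee_fin alpha_nonneg.
- by move=> t tl; apply: sume_ge0 => j _; exact: rG0.
- exact: emeasurable_sum.
rewrite integral_cst//= lebesgue_measure_itv /= lte_fin l_gt0 -EFinB subr0
  -EFinM.
rewrite ge0_integral_sum// big_enum /= EFinD -sumEFin; congr (_ + _)%E.
apply: eq_bigr => j _; rewrite ge0_integralZl_EFin//; last 2 first.
- by move=> t /=; rewrite in_itv /= => /andP[t0 _]; rewrite lee_fin G_ge0.
- by apply/measurable_EFinP; apply: measurable_funTS; exact: (mG j).
by rewrite QP ?ltW// EFinM.
Qed.

Lemma expected_layered_cost_gt0 :
  (\int[P]_u (period_cost (layered_schedule u) l)%:E =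
   (alpha D ord_max * l + \sum_(j < m) chain_rate j * Q j l +
    \sum_(j < m) chain_price j * (1 - G j l))%:E)%E.
Proof.
have b0 (j : 'I_m) : 0 <= chain_price j by apply/ltW/chain_price_gt0.
have mlt (j : 'I_m) : measurable_fun [set: measurableTypeR R]
    (fun u : measurableTypeR R => ((G j l < u)%R%:R)%:E : \bar R).
  apply/measurable_EFinP/measurable_fun_nat_of_bool.
  by apply: measurable_fun_ltr => //; exact: measurable_cst.
have mblt (j : 'I_m) : measurable_fun [set: measurableTypeR R]
    (fun u : measurableTypeR R => (chain_price j)%:E * ((G j l < u)%R%:R)%:E)%E.
  by apply: emeasurable_funM => //; exact: mlt.
have P_lt (j : 'I_m) : (\int[P]_u ((G j l < u)%R%:R)%:E = (1 - G j l)%:E)%E.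
  have -> : (\int[P]_u ((G j l < u)%R%:R)%:E =
      \int[P]_u (1%:E - ((u <= G j l)%R%:R)%:E))%E.
    apply: eq_integral => u _; rewrite -EFinB ltNge.
    by case: (_ <= _); rewrite ?subrr ?subr0.
  rewrite integralB_EFin//.
  - by rewrite integral_cst//= probability_setT mule1 P_le ?G_ge0 ?G_le1 ?ltW.
  - exact: finite_measure_integrable_cst.
  - apply: (@le_integrable _ _ _ P _ measurableT _ (EFin \o cst 1)).
    + apply/measurable_EFinP/measurable_fun_nat_of_bool.
      by apply: measurable_fun_ler => //; exact: measurable_cst.
    + by move=> u _ /=; rewrite lee_fin normr1 ger0_norm// lern1 leq_b1.
    + exact: finite_measure_integrable_cst.
have -> : (\int[P]_u (period_cost (layered_schedule u) l)%:E =
    \int[P]_u (fubini_F leb (EFin \o h) u +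
      \sum_(j <- enum 'I_m) (chain_price j)%:E * ((G j l < u)%R%:R)%:E))%E.
  apply: eq_integral => u _; rewrite /period_cost EFinD residence_layered.
  by rewrite beta_layered// big_enum /= -sumEFin.
rewrite ge0_integralD//; last 4 first.
- by move=> u _; apply: integral_ge0 => t _; rewrite lee_fin.
- apply: measurable_fun_fubini_tonelli_F; first exact/measurable_EFinP.
  by move=> z; rewrite lee_fin.
- by move=> u _; apply: sume_ge0 => j _; rewrite mule_ge0// lee_fin.
- exact: emeasurable_sum.
rewrite expected_residence [RHS]EFinD; congr (_ + _)%E.
rewrite ge0_integral_sum//; last by move=> j u _; rewrite mule_ge0// lee_fin.
rewrite big_enum /= -sumEFin; apply: eq_bigr => j _.
by rewrite ge0_integralZl_EFin// P_lt EFinM.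
Qed.

End Length.

(** Only an inequality, because of [l = 0]: the period then ends in state 0 at no cost, while the
    formula still charges the atoms. *)
Lemma layered_cost (l : R) : 0 <= l ->
  measurable_fun setT (fun u : R => period_cost (layered_schedule u) l) /\
  (\int[P]_u (period_cost (layered_schedule u) l)%:E <=
   (alpha D ord_max * l + \sum_(j < m) chain_rate j * Q j l +
    \sum_(j < m) chain_price j * (1 - G j l))%:E)%E.
Proof.
rewrite le_eqVlt => /predU1P[<-|l_gt0]; last first.
  by split; [exact: measurable_layered_cost|rewrite expected_layered_cost_gt0].
have cost0 (u : R) : period_cost (layered_schedule u) 0 = 0.
  have := residence_cost (layered_schedule u) (lexx 0).
  rewrite set_itv1 integral_set1 => -[Hres].
  by rewrite /period_cost Hres state_at0 beta0 addr0.
split; first by under eq_fun do rewrite cost0; exact: measurable_cst.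
rewrite integral0_eq => [|u _]; last by rewrite cost0.
rewrite lee_fin mulr0 add0r addr_ge0// sumr_ge0// => j _.
  have := @QP j 0 (ltn_ord j) (lexx _); rewrite set_itv1 integral_set1 => -[<-].
  by rewrite mulr0.
by rewrite mulr_ge0 ?(ltW (chain_price_gt0 _))// subr_ge0 G_le1.
Qed.

End Layered.

End Schedules.


(** * Convex chains of states *)

Section Chain.
Variables (R : realType) (D : dpm_system R).
Local Notation state := 'I_(nb_sleep D).+1.

Definition is_chain (m : nat) (c : nat -> state) : Prop :=
  [/\ c 0%N = ord0, c m = ord_max &
      forall j, (j < m)%N -> (c j < c j.+1)%N].

Definition chain_dominates (m : nat) (c : nat -> state) : Prop :=
  forall (i : state) (t : R), 0 <= t -> exists2 j, (j <= m)%N &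
    alpha D (c j) * t + beta D (c j) <= alpha D i * t + beta D i.

Definition chain_scale (c : nat -> state) j : R :=
  chain_price c j / chain_rate c j.

(** If the scale drops after [j], the cost line of [c j.+1] is nowhere strictly below both
    neighbours. Deleting that state keeps domination, and the induction is on the length of the
    chain. *)
Lemma convex_chain_of_chain m (c : nat -> state) :
  is_chain m c -> chain_dominates m c ->
  exists m' c', [/\ is_chain m' c', chain_dominates m' c' &
    forall j, (j.+1 < m')%N -> chain_scale c' j <= chain_scale c' j.+1].
Proof.
elim: m c => [|m IH] c cP cD; first by exists 0%N, c.
have [cvx|] := pselect (forall j, (j < m)%N ->
  chain_scale c j <= chain_scale c j.+1).
  by exists m.+1, c.
move=> /existsNP[j /not_implyP[jm /negP]]; rewrite -ltNge => ncvx.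
have [c0 cm cS] := cP.
pose c' i := if (i <= j)%N then c i else c i.+1.
apply: (IH c').
  split; first by [].
    by rewrite /c' leqNgt jm.
  rewrite /c' => i im; case: (ltngtP i j) => ij.
  - by rewrite cS// ltnW.
  - by rewrite cS.
  - by rewrite ij (ltn_trans (cS j _))// ?cS// ltnW.
move=> i t t0; have [n nm nle] := cD i t t0.
have rj := chain_rate_gt0 cS (ltnW jm : (j < m.+1)%N).
have rj1 := chain_rate_gt0 cS (jm : (j.+1 < m.+1)%N).
have [nj|nj|nj] := ltngtP n j.+1.
- exists n; first by rewrite (leq_trans _ (ltnW jm)).
  by rewrite /c' -ltnS nj.
- case: n nm nle nj => // n nm nle nj.
  exists n; first by rewrite -ltnS.
  by rewrite /c' leqNgt -ltnS nj.
- rewrite nj in nle.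
  (* Up to [chain_scale c j] the state [c j] is as good as [c j.+1]; later [t] also exceeds
     [chain_scale c j.+1], and [c j.+2], now at index [j.+1], is better. *)
  have [ts|st] := leP t (chain_scale c j).
    exists j; first exact: ltnW.
    apply: le_trans nle; rewrite /c' leqnn.
    move: ts; rewrite /chain_scale ler_pdivlMr// /chain_rate /chain_price; lra.
  exists j.+1 => //; apply: le_trans nle; rewrite /c' ltnn.
  have := lt_trans ncvx st.
  rewrite /chain_scale ltr_pdivrMr// /chain_rate /chain_price; lra.
Qed.

Lemma convex_chain : exists m c, [/\ is_chain m c,
  forall i j, (i <= j < m)%N -> chain_scale c i <= chain_scale c j &
  forall (i : state) (t : R), 0 <= t ->
    alpha D ord_max * t +
      \sum_(j < m) Num.min (chain_rate c j * t) (chain_price c j) <=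
    alpha D i * t + beta D i].
Proof.
have cP : is_chain (nb_sleep D) (@inord (nb_sleep D)).
  split; [by apply/val_inj; rewrite /= inordK|by apply/val_inj; rewrite /=
    inordK|].
  by move=> j jm; rewrite !inordK// ltnS// ltnW.
have cD : chain_dominates (nb_sleep D) (@inord (nb_sleep D)).
  by move=> i t t0; exists (i : nat); [rewrite -ltnS|rewrite inord_val].
have [m [c [cc dom cvx]]] := convex_chain_of_chain cP cD.
exists m, c; split => // [i j /andP[+ jm]|i t t0].
  elim: j jm => [|j IH] jm; first by rewrite leqn0 => /eqP ->.
  rewrite leq_eqVlt => /orP[/eqP ->//|ij].
  by apply: le_trans (cvx _ jm); apply: IH => //; exact: ltnW.
have [n nm nle] := dom i t t0; have [c0 cm cS] := cc.
apply: le_trans nle.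
(* Each minimum is bounded by the price below [n] and by the rent from [n] on; both sums telescope
   to the cost of staying in [c n]. *)
rewrite -(big_mkord xpredT
  (fun j => Num.min (chain_rate c j * t) (chain_price c j))).
rewrite (big_cat_nat (n := n))//=.
have h1 : \sum_(0 <= j < n) Num.min (chain_rate c j * t) (chain_price c j) <=
    beta D (c n).
  have -> : beta D (c n) = \sum_(0 <= j < n) chain_price c j.
    by rewrite (telescope_sumr (fun j => beta D (c j)))// c0 beta0 subr0.
  by apply: ler_sum => j _; rewrite ge_min lexx orbT.
have h2 : \sum_(n <= j < m) Num.min (chain_rate c j * t) (chain_price c j) <=
    (alpha D (c n) - alpha D (c m)) * t.
  have -> : (alpha D (c n) - alpha D (c m)) * t =
      \sum_(n <= j < m) chain_rate c j * t.
    rewrite -mulr_suml (telescope_sumr_eq (fun j => - alpha D (c j)))//.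
      by ring.
    by move=> j _; rewrite opprK addrC.
  by apply: ler_sum => j _; rewrite ge_min lexx.
by move: h1 h2; rewrite cm; lra.
Qed.

Lemma schedule_exists : exists s : schedule D, True.
Proof.
by exists (@Schedule _ D (fun=> ord0) erefl (fun _ _ _ _ => leqnn _)).
Qed.

Lemma OPT_ge (f : R -> R) inst :
  (forall (i : state) (t : R), 0 <= t -> f t <= alpha D i * t + beta D i) ->
  \sum_(p <- inst) f (duration p) <= OPT D inst.
Proof.
move=> fP; apply: lb_le_inf.
  have [s _] := schedule_exists.
  by exists (@offline_cost _ D inst (fun=> s)), (fun=> s).
move=> _ [S _ <-]; rewrite /offline_cost big_tnth.
apply: ler_sum => i _; have l0 := duration_ge0 (tnth (in_tuple inst) i).
by apply: le_trans (period_cost_ge _ l0); exact: fP.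
Qed.

End Chain.


Definition is_primitive (R : realType) (g P : R -> R) : Prop :=
  [/\ P 0 = 0,
    forall x : R, 0 <= x -> is_derive x 1 P (g x) &
    forall l : R, 0 <= l ->
      (\int[@lebesgue_measure R]_(t in `[0%R, l]) (g t)%:E = (P l)%:E)%E].

(** A total choice, so that [rent] depends on [g] alone; the default serves only functions without a
    primitive. *)
Definition primitive (R : realType) (g : R -> R) : R -> R :=
  xget (fun=> 0) (is_primitive g).

Lemma primitiveP (R : realType) (g : R -> R) : continuous g ->
  is_primitive g (primitive g).
Proof. by move=> /continuous_primitive; exact: xgetPex. Qed.

Lemma continuous_sum_at (R : realType) (n : nat) (F : 'I_n -> R -> R) (x : R) :
  (forall i, {for x, continuous (F i)}) ->
  {for x, continuous (fun t => \sum_(i < n) F i t)}.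
Proof.
by move=> cF; apply: cvg_big => [|i _]; [exact: add_continuous|exact: cF].
Qed.

(** * Combining experts *)

Section Experts.
Variables (R : realType) (D : dpm_system R) (m : nat).
Variable c : nat -> 'I_(nb_sleep D).+1.
Hypothesis cP : is_chain m c.

Let c0 : c 0%N = ord0. Proof. by case: cP. Qed.
Let cm : c m = ord_max. Proof. by case: cP. Qed.
Let cS j : (j < m)%N -> (c j < c j.+1)%N. Proof. by case: cP => _ _; exact. Qed.
Local Notation rate := (chain_rate c).
Local Notation price := (chain_price c).

Let rate0 (j : 'I_m) : 0 <= rate j. Proof. exact: (ltW (chain_rate_gt0 cS
  (ltn_ord j))). Qed.
Let price0 (j : 'I_m) : 0 <= price j. Proof. exact: (ltW (chain_price_gt0 cS
  (ltn_ord j))). Qed.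

Let sum_price : \sum_(j < m) price j = beta D ord_max.
Proof.
rewrite -(big_mkord xpredT price) (telescope_sumr (fun j => beta D (c j)))//.
by rewrite c0 cm beta0 subr0.
Qed.

(* Probabilities of not having left each layer by time [t]. *)
Record layers_spec (g : nat -> R -> R) : Prop := LayersSpec {
  layers_cont : forall j, (j < m)%N -> continuous (g j);
  layers_ge0 : forall j (t : R), (j < m)%N -> 0 <= t -> 0 <= g j t;
  layers_le1 : forall j (t : R), (j < m)%N -> 0 <= t -> g j t <= 1;
  layers_noninc : forall j (t t' : R), (j < m)%N -> 0 <= t -> t <= t' ->
    g j t' <= g j t;
  layers_homo : forall i j (t : R), (i <= j < m)%N -> 0 <= t -> g i t <= g j t
}.

Definition rent (g : nat -> R -> R) (t : R) : R :=
  \sum_(j < m) rate j * primitive (g j) t.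

Definition wake (g : nat -> R -> R) (t : R) : R :=
  \sum_(j < m) price j * (1 - g j t).

(** The rent at the power of the deepest state is common to all strategies and is left out;
    [layered_loss] adds it back. *)
Definition loss (g : nat -> R -> R) (t : R) : R := rent g t + wake g t.

Lemma layered_loss (g : nat -> R -> R) : layers_spec g ->
  exists S : R -> schedule D, forall l : R, 0 <= l ->
    measurable_fun setT (fun u : R => period_cost (S u) l) /\
    (\int[uniform_prob (@ltr01 R)]_u (period_cost (S u) l)%:E <=
     (alpha D ord_max * l + loss g l)%:E)%E.
Proof.
move=> gP; exists (layered_schedule cS (layers_noninc gP)) => l l0.
have QP j (x : R) : (j < m)%N -> 0 <= x ->
    (\int[@lebesgue_measure R]_(t in `[0%R, x]) (g j t)%:E =
     (primitive (g j) x)%:E)%E.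
  by move=> jm; have [_ _] := primitiveP (layers_cont gP jm); exact.
have := layered_cost c0 cm cS (layers_cont gP) (layers_ge0 gP) (layers_le1 gP)
  (layers_noninc gP) (layers_homo gP) QP l0.
by rewrite /loss /rent /wake addrA.
Qed.

Section Single.
Variables (g : nat -> R -> R) (gP : layers_spec g).

Lemma is_derive_rent (t : R) : 0 <= t ->
  is_derive t 1 (rent g) (\sum_(j < m) rate j * g j t).
Proof.
move=> t0.
have -> : rent g = \sum_(j < m) (rate j \*: primitive (g j)).
  by apply/funext => x; rewrite fct_sumE.
apply: is_derive_sum => j.
have [_ dq _] := primitiveP (layers_cont gP (ltn_ord j)).
have dqt := dq _ t0.
exact: is_deriveZ.
Qed.

Lemma rent0 : rent g 0 = 0.
Proof.
rewrite /rent big1// => j _.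
by have [-> _ _] := primitiveP (layers_cont gP (ltn_ord j)); rewrite mulr0.
Qed.

Lemma rent_homo (t t' : R) : 0 <= t -> t <= t' -> rent g t <= rent g t'.
Proof.
move=> t0 tt'; apply: (is_derive_ge0_le tt') => x /andP[/(le_trans t0) x0 _].
  exact: is_derive_rent.
by apply: sumr_ge0 => j _; rewrite mulr_ge0// (layers_ge0 gP).
Qed.

Lemma wake_homo (t t' : R) : 0 <= t -> t <= t' -> wake g t <= wake g t'.
Proof.
move=> t0 tt'; apply: ler_sum => j _.
by rewrite ler_wpM2l// lerB// (layers_noninc gP).
Qed.

Lemma wake_ge0 (t : R) : 0 <= t -> 0 <= wake g t.
Proof.
move=> t0; apply: sumr_ge0 => j _.
by rewrite mulr_ge0// subr_ge0 (layers_le1 gP).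
Qed.

Lemma rent_ge0 (t : R) : 0 <= t -> 0 <= rent g t.
Proof. by move=> t0; rewrite -rent0 rent_homo. Qed.

Lemma loss_ge0 (t : R) : 0 <= t -> 0 <= loss g t.
Proof. by move=> t0; rewrite addr_ge0 ?rent_ge0 ?wake_ge0. Qed.

Lemma loss_homo (t t' : R) : 0 <= t -> t <= t' -> loss g t <= loss g t'.
Proof. by move=> t0 tt'; rewrite lerD ?rent_homo ?wake_homo. Qed.

Lemma continuous_loss (t : R) : 0 <= t -> {for t, continuous (loss g)}.
Proof.
move=> t0; apply: cvgD.
  apply/differentiable_continuous/derivable1_diffP.
  by have dr := is_derive_rent t0; exact: ex_derive.
apply: continuous_sum_at => j; apply: cvgM; first exact: cvg_cst.
by apply: cvgB; [exact: cvg_cst|exact: (layers_cont gP)].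
Qed.

End Single.

(** * Discounting experts within one period *)

Section Mixture.
Variables (n : nat) (p : 'I_n -> R) (g : 'I_n -> nat -> R -> R) (lam : R).
Hypotheses (p0 : forall i, 0 <= p i) (p1 : \sum_(i < n) p i = 1)
  (gP : forall i, layers_spec (g i)) (lam0 : 0 < lam).

(* Expert [i] is discounted within the period by its own loss so far: with
   rate [lam] per unit of loss it gives up and jumps to the deepest state. *)
Definition mixture (j : nat) (t : R) : R :=
  \sum_(i < n) p i * (g i j t * expR (- (lam * loss (g i) (Num.max t 0)))).

Let mixtureE j (t : R) : 0 <= t -> mixture j t =
  \sum_(i < n) p i * (g i j t * expR (- (lam * loss (g i) t))).
Proof. by move=> t0; rewrite /mixture (max_idPl t0). Qed.

Let discount_le1 i (t : R) : 0 <= t -> expR (- (lam * loss (g i) t)) <= 1.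
Proof.
move=> t0; rewrite -[leRHS]expR0 ler_expR oppr_le0 mulr_ge0 ?(ltW lam0)//.
exact: loss_ge0.
Qed.

Lemma mixture_spec : layers_spec mixture.
Proof.
split.
- move=> j jm t; apply: continuous_sum_at => i.
  apply: cvgM; first exact: cvg_cst.
  apply: cvgM; first exact: (layers_cont (gP i)).
  apply: (@continuous_comp R R R (fun t : R => - (lam * loss (g i) (Num.max t
    0))) expR);
    last exact: continuous_expR.
  apply: cvgN; apply: cvgM; first exact: cvg_cst.
  (* Continuity is required on the whole line but [loss] is only controlled at nonnegative times,
     hence the truncation. *)
  apply: (@continuous_comp R R R (fun t : R => Num.max t 0) (loss (g i))).
    by apply: (@continuous_max R R id (fun=> 0)) => //; exact: cst_continuous.
  by apply: continuous_loss => //; rewrite le_max lexx orbT.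
- move=> j t jm t0; rewrite mixtureE//; apply: sumr_ge0 => i _.
  by rewrite !mulr_ge0 ?expR_ge0// (layers_ge0 (gP i)).
- move=> j t jm t0; rewrite mixtureE// -p1; apply: ler_sum => i _.
  rewrite ler_piMr// mulr_ile1 ?expR_ge0 ?discount_le1//.
    exact: (layers_ge0 (gP i)).
  exact: (layers_le1 (gP i)).
- move=> j t t' jm t0 tt'; have t'0 := le_trans t0 tt'.
  rewrite !mixtureE//; apply: ler_sum => i _.
  rewrite ler_wpM2l//; apply: ler_pM; rewrite ?expR_ge0//.
  + exact: (layers_ge0 (gP i)).
  + exact: (layers_noninc (gP i)).
  + by rewrite ler_expR lerN2 ler_wpM2l ?(ltW lam0)// loss_homo.
- move=> j j' t jj' t0; rewrite !mixtureE//; apply: ler_sum => i _.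
  by rewrite ler_wpM2l// ler_wpM2r ?expR_ge0// (layers_homo (gP i)).
Qed.

(** Comparison of derivatives: expert [i] pays rent discounted by its loss, which is at least its
    rent, and discounting by the rent alone integrates exactly. *)
Let mixture_rent (l : R) : 0 <= l ->
  rent mixture l <= \sum_(i < n) p i * ((1 - expR (- (lam * rent (g i) l))) /
    lam).
Proof.
move=> l0.
pose B (t : R) := \sum_(i < n) p i * ((1 - expR (- (lam * rent (g i) t))) /
  lam).
pose dB (t : R) := \sum_(i < n) p i *
  ((\sum_(j < m) rate j * g i j t) * expR (- (lam * rent (g i) t))).
have BP (t : R) : 0 <= t -> is_derive t 1 B (dB t).
  move=> t0.
  have -> : B = \sum_(i < n)
      (fun t => p i * ((1 - expR (- (lam * rent (g i) t))) / lam)).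
    by apply/funext => x; rewrite fct_sumE.
  apply: is_derive_sum => i.
  have dr := is_derive_rent (gP i) t0.
  have dl : is_derive t 1 (fun x => - (lam * rent (g i) x))
      (- (lam * \sum_(j < m) rate j * g i j t)).
    by apply: is_derive_eq; rewrite /GRing.scale /=; ring.
  have de : is_derive t 1 (fun x => expR (- (lam * rent (g i) x)))
      (expR (- (lam * rent (g i) t)) * - (lam * \sum_(j < m) rate j * g i j t)).
    exact: (is_derive1_comp (is_derive_expR _) dl).
  apply: is_derive_eq; rewrite /GRing.scale /=.
  by field; rewrite gt_eqF.
suff : B 0 - rent mixture 0 <= B l - rent mixture l.
  rewrite rent0; last exact: mixture_spec.
  have -> : B 0 = 0.
    by rewrite /B big1// => i _; rewrite rent0// mulr0 oppr0 expR0 subrr mul0r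
      mulr0.
  by rewrite /B; lra.
apply: (@is_derive_ge0_le _ (fun t => B t - rent mixture t)
  (fun t => dB t - \sum_(j < m) rate j * mixture j t)) => // t /andP[t0 _].
  have := is_derive_rent mixture_spec t0; have := BP _ t0 => dBt drt.
  by apply: is_derive_eq.
rewrite subr_ge0.
have -> : \sum_(j < m) rate j * mixture j t = \sum_(i < n) p i *
    ((\sum_(j < m) rate j * g i j t) * expR (- (lam * loss (g i) t))).
  under eq_bigr do rewrite mixtureE// mulr_sumr.
  rewrite exchange_big /=; apply: eq_bigr => i _.
  rewrite mulr_suml mulr_sumr; apply: eq_bigr => j _; ring.
apply: ler_sum => i _; rewrite ler_wpM2l// ler_wpM2l//.
  by apply: sumr_ge0 => j _; rewrite mulr_ge0// (layers_ge0 (gP i)).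
rewrite ler_expR lerN2 ler_wpM2l ?(ltW lam0)// /loss lerDl.
exact: wake_ge0.
Qed.

(** For one expert with wake-up cost [V] and discount [E], the rent bound is
    [(1 - E * expR (lam * V)) / lam]. By [1 + lam * V <= expR (lam * V)] it saves [V * E], exactly
    the part of the wake-up cost due to the expert's own moves; giving up costs the remaining
    [B * (1 - E)]. *)
Lemma mixture_loss (l : R) : 0 <= l ->
  loss mixture l <= (1 + lam * beta D ord_max) / lam *
    (1 - \sum_(i < n) p i * expR (- (lam * loss (g i) l))).
Proof.
move=> l0; rewrite /loss.
have -> : wake mixture l = \sum_(i < n) p i *
    (beta D ord_max - (beta D ord_max - wake (g i) l) *
      expR (- (lam * loss (g i) l))).
  rewrite /wake.
  under eq_bigr do rewrite mixtureE// -[X in X - _]p1 -sumrB mulr_sumr.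
  rewrite exchange_big /=; apply: eq_bigr => i _.
  rewrite -sum_price -sumrB mulr_suml -sumrB mulr_sumr.
  by apply: eq_bigr => j _; ring.
apply: (le_trans (lerD (mixture_rent l0) (lexx _))).
rewrite -[X in _ <= _ * (X - _)]p1 -sumrB -big_split mulr_sumr; apply: ler_sum
  => i _ /=.
rewrite -mulrDr.
have -> : (1 + lam * beta D ord_max) / lam *
    (p i - p i * expR (- (lam * loss (g i) l))) =
  p i * ((1 + lam * beta D ord_max) / lam * (1 - expR (- (lam * loss (g i)
    l)))).
  by ring.
rewrite ler_wpM2l// -(ler_pM2r lam0).
set B := beta D ord_max; set V := wake (g i) l.
have V0 : 0 <= V by exact: wake_ge0.
have -> : expR (- (lam * rent (g i) l)) =
    expR (- (lam * loss (g i) l)) * expR (lam * V).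
  by rewrite -expRD; congr expR; rewrite /loss -/V; ring.
set E := expR (- (lam * loss _ _)).
have : E * (1 + lam * V) <= E * expR (lam * V).
  by rewrite ler_wpM2l ?expR_ge0// expR_ge1Dx.
set F := E * expR _ => EF.
have -> : ((1 - F) / lam + (B - (B - V) * E)) * lam =
  1 - F + lam * B - lam * (B * E) + lam * (V * E).
  by field; rewrite gt_eqF.
have -> : (1 + lam * B) / lam * (1 - E) * lam =
  1 - E + lam * B - lam * (B * E) by field; rewrite gt_eqF.
lra.
Qed.

End Mixture.

(** * Multiplicative weights across periods *)

Section Hedge.
Variables (n : nat) (g : 'I_n.+1 -> R -> nat -> R -> R) (lam : R).
Hypotheses (gP : forall i (tau : R), 0 <= tau -> layers_spec (g i tau))
  (lam0 : 0 < lam).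

Definition total_loss (i : 'I_n.+1) (past : seq (period R)) : R :=
  \sum_(p <- past) loss (g i (predicted p)) (duration p).

Definition hedge_weight (past : seq (period R)) (i : 'I_n.+1) : R :=
  expR (- (lam * total_loss i past)).

Definition hedge_potential (past : seq (period R)) : R :=
  \sum_(i < n.+1) hedge_weight past i.

Lemma hedge_potential_gt0 past : 0 < hedge_potential past.
Proof.
rewrite /hedge_potential (bigD1 ord0)//=.
rewrite ltr_wpDr ?expR_gt0//; apply: sumr_ge0 => i _; exact: expR_ge0.
Qed.

Let K := (1 + lam * beta D ord_max) / lam.

Let beta_max_ge0 : 0 <= beta D ord_max.
Proof. by rewrite -(beta0 D) beta_homo. Qed.

Let K_ge0 : 0 <= K.
Proof. by rewrite divr_ge0 ?(ltW lam0)// addr_ge0// mulr_ge0// ltW. Qed.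

(** The weight ratio [x] after and before the period turns the bound of [mixture_loss] into a
    potential difference, by [1 - x <= - ln x]. *)
Lemma hedge_step (past : seq (period R)) (tau : R) :
  exists S : R -> schedule D, 0 <= tau -> forall l : R, 0 <= l ->
    measurable_fun setT (fun u : R => period_cost (S u) l) /\
    (\int[uniform_prob (@ltr01 R)]_u (period_cost (S u) l)%:E <=
     (alpha D ord_max * l + K * (ln (hedge_potential past) -
       ln (\sum_(i < n.+1) hedge_weight past i *
             expR (- (lam * loss (g i tau) l)))))%:E)%E.
Proof.
have [tau0|tau0] := leP 0 tau; last first.
  (* A [policy] must also answer negative arguments; any schedule will do there. *)
  by have [s _] := schedule_exists D; exists (fun=> s).
pose p i := hedge_weight past i / hedge_potential past.
have p0 i : 0 <= p i.
  by rewrite divr_ge0 ?expR_ge0// ltW// hedge_potential_gt0.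
have p1 : \sum_i p i = 1.
  by rewrite -mulr_suml divff// gt_eqF// hedge_potential_gt0.
have gP' i := gP i tau0.
have [S SP] := layered_loss (mixture_spec p0 p1 gP' lam0).
exists S => _ l l0; have [mS SE] := SP l l0; split => //.
apply: (le_trans SE); rewrite lee_fin lerD2l.
apply: (le_trans (mixture_loss p0 p1 gP' lam0 l0)).
rewrite ler_wpM2l//.
set W' := (X in _ <= _ - ln X).
have W0 := hedge_potential_gt0 past.
have W'0 : 0 < W'.
  rewrite /W' (bigD1 ord0)//= ltr_wpDr ?mulr_gt0 ?expR_gt0//.
  by apply: sumr_ge0 => i _; rewrite mulr_ge0 ?expR_ge0.
have -> : \sum_(i < n.+1) p i * expR (- (lam * loss (g i tau) l)) =
    W' / hedge_potential past.
  by rewrite mulr_suml; apply: eq_bigr => i _; rewrite mulrAC.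
have := @le_ln1Dx R (W' / hedge_potential past - 1).
rewrite ltrBrDr addNr divr_gt0// => /(_ isT).
rewrite addrCA subrr addr0 ln_div ?posrE//.
lra.
Qed.

(** The weights depend on the past input and not on the seed, so one seed can serve all periods:
    linearity of expectation is enough, and the potentials telescope. *)
Lemma hedge : exists A : algorithm D, forall inst i,
  (expected_cost A inst <= (\sum_(q <- inst) alpha D ord_max * duration q +
     K * (ln n.+1%:R + lam * total_loss i inst))%:E)%E.
Proof.
have [S0 S0P] := choice (fun x : seq (period R) * R => hedge_step x.1 x.2).
pose run (u : measurableTypeR R) : policy D := fun past tau => S0 (past, tau) u.
pose P : probability _ R := uniform_prob (@ltr01 R).
have costP inst : forall past,
    measurable_fun setT (fun u => cost_from (run u) past inst) /\
    (\int[P]_u (cost_from (run u) past inst)%:E <=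
     (\sum_(q <- inst) alpha D ord_max * duration q +
      K * (ln (hedge_potential past) - ln (hedge_potential (past ++
        inst))))%:E)%E.
  elim: inst => [|q inst IH] past.
    split; first exact: measurable_cst.
    by rewrite integral0_eq// cats0 big_nil subrr mulr0 addr0.
  have [m1 i1] := S0P (past, predicted q) (predicted_ge0 q) _ (duration_ge0 q).
  have [m2 i2] := IH (rcons past q).
  split => /=; first exact: measurable_funD.
  have cost_ge0 (A : policy D) past' inst' : 0 <= cost_from A past' inst'.
    elim: inst' past' => //= q' inst' IH' past'.
    by rewrite addr_ge0// period_cost_ge0// duration_ge0.
  under eq_integral do rewrite EFinD.
  rewrite ge0_integralD//; last 4 first.
  - by move=> u _; rewrite lee_fin period_cost_ge0// duration_ge0.
  - exact/measurable_EFinP.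
  - by move=> u _; rewrite lee_fin.
  - exact/measurable_EFinP.
  apply: (le_trans (leeD i1 i2)).
  rewrite -EFinD lee_fin big_cons cat_rcons.
  have -> : hedge_potential (rcons past q) = \sum_(i < n.+1)
      hedge_weight past i * expR (- (lam * loss (g i (predicted q)) (duration
        q))).
    apply: eq_bigr => i _; rewrite /hedge_weight /total_loss big_rcons /=
      -expRD.
    by congr expR; rewrite mulrDr opprD addrC.
  by rewrite /=; lra.
exists (@Algorithm R D _ _ P run (fun inst => (costP inst [::]).1)) => inst i.
rewrite /expected_cost unlock /=.
apply: (le_trans (costP inst [::]).2).
rewrite lee_fin lerD2l ler_wpM2l// cat0s.
have -> : hedge_potential [::] = n.+1%:R.
  rewrite /hedge_potential (eq_bigr (fun=> 1)) => [|j _].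
    by rewrite sumr_const card_ord.
  by rewrite /hedge_weight /total_loss big_nil mulr0 oppr0 expR0.
(* The final potential is at least the weight of expert [i] alone. *)
rewrite lerD2l lerNl -[leLHS]expRK ler_ln ?posrE ?expR_gt0
  ?hedge_potential_gt0//.
rewrite /hedge_potential (bigD1 i)//= lerDl sumr_ge0// => j _; exact: expR_ge0.
Qed.

End Hedge.

End Experts.


(** * The tradeoff curve *)

Section TradeoffCurve.
Variable R : realType.
Implicit Types rho T y z : R.
Local Notation e := (expR 1 : R).

(* The line is the tangent at [T] of the function [z * expR (- z)]. *)
Lemma mulr_expRN_le_tangent T z : 0 <= T <= 1 -> 0 <= z ->
  z * expR (- z) <= T ^+ 2 * expR (- T) + (1 - T) * expR (- T) * z.
Proof.
move=> /andP[T0 T1] z0.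
have -> : T ^+ 2 * expR (- T) + (1 - T) * expR (- T) * z =
  (T ^+ 2 + (1 - T) * z) * expR (- T) by ring.
have H0 : 0 <= T ^+ 2 + (1 - T) * z.
  by rewrite addr_ge0 ?sqr_ge0// mulr_ge0// subr_ge0.
have -> : expR (- z) = expR (- T) / expR (z - T).
  by rewrite -expRN -expRD; congr expR; ring.
rewrite mulrCA mulrC ler_pM2r ?expR_gt0// ler_pdivrMr ?expR_gt0//.
apply: (@le_trans _ _ ((T ^+ 2 + (1 - T) * z) * (1 + (z - T)))); last first.
  by rewrite ler_wpM2l// expR_ge1Dx.
rewrite -subr_ge0.
have -> : (T ^+ 2 + (1 - T) * z) * (1 + (z - T)) - z = (1 - T) * (z - T) ^+ 2.
  by ring.
by rewrite mulr_ge0 ?sqr_ge0// subr_ge0.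
Qed.

Lemma ln2_le y : ln 2 <= y - 1 + 2 * expR (- y).
Proof.
have e2 : 2 = expR (ln 2) :> R by rewrite lnK// posrE.
have := expR_ge1Dx (ln 2 - y); rewrite expRD -e2; lra.
Qed.

Lemma rho_range1 : @rho_range R 1.
Proof.
have e1 : 1 < e by rewrite expR_gt1.
by rewrite /rho_range /= lexx ler_pdivlMr ?subr_gt0// mul1r; lra.
Qed.

Lemma mu_tradeoff_pair rho : rho_range rho -> tradeoff_pair rho (mu rho).
Proof.
move=> rP; have [T01 TE] := mu_TP rP.
move: rP => /= /andP[r1 re].
have e1 : 1 < e by rewrite expR_gt1.
have e0 : 0 < e by exact: expR_gt0.
have r0 : 0 < rho by rewrite (lt_le_trans _ r1).
have ln2 : 2^-1 <= ln 2 :> R.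
  have := @le_ln1Dx R (- 2^-1); have -> : 1 - 2^-1 = 2^-1 :> R by lra.
  rewrite lnV ?posrE// lerN2; apply; lra.
have eV : (e - 1) / e = 1 - expR (- 1) by rewrite expRN mulrBl divff ?gt_eqF//
  mul1r.
have q0 : 0 <= 1 - rho * (1 - expR (- 1)).
  rewrite subr_ge0 -eV mulrA ler_pdivrMr// mul1r.
  by move: re; rewrite ler_pdivlMr ?subr_gt0.
have muge1 : 1 - rho * (1 - expR (- 1)) <= mu rho * ln 2.
  rewrite -ler_pdivrMr; last by lra.
  by rewrite /mu le_max eV lexx.
have muge2 : rho * (1 - mu_T rho) * expR (- mu_T rho) <= mu rho.
  by rewrite /mu le_max lexx orbT.
have mu0 : 0 <= mu rho.
  rewrite (le_trans _ muge2)// !mulr_ge0 ?expR_ge0 ?(ltW r0)// subr_ge0.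
  by case/andP: T01.
have rT : rho - 1 = rho * (mu_T rho ^+ 2 * expR (- mu_T rho)).
  by rewrite TE mulrBr divff ?gt_eqF// mulr1.
split => //.
- rewrite mu0 /= /mu ge_max; apply/andP; split.
    rewrite eV ler_pdivrMr; last by lra.
    have : expR (- 1) <= 2^-1 :> R.
      rewrite expRN lef_pV2 ?posrE//.
      by have := expR_ge1Dx (1 : R); lra.
    have : 0 <= (rho - 1) * (1 - expR (- 1)).
      by rewrite mulr_ge0 ?subr_ge0// expRN invf_le1// ltW.
    lra.
  case/andP: T01 rT; set T := mu_T rho => T0 T1 rT.
  (* Writing 1 in this form lets [rho] cancel, leaving an inequality in [T] only. *)
  have rE : rho * (1 - T ^+ 2 * expR (- T)) = 1 by rewrite mulrBr -rT; ring.
  rewrite -[leRHS]rE -mulrA ler_wpM2l ?(ltW r0)//.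
  suff : (1 - T + T ^+ 2) * expR (- T) <= 1 by lra.
  rewrite expRN ler_pdivrMr ?expR_gt0// mul1r.
  have : T ^+ 2 <= T by rewrite expr2 ler_piMr.
  by have := expR_ge1Dx T; lra.
- move=> z z0; rewrite rT -mulrA.
  have H := mulr_expRN_le_tangent T01 z0.
  have {}H : rho * (z * expR (- z)) <= rho * (mu_T rho ^+ 2 * expR (- mu_T rho)
    +
      (1 - mu_T rho) * expR (- mu_T rho) * z) by rewrite ler_wpM2l// ltW.
  apply: (le_trans H); rewrite mulrDr lerD2l !mulrA.
  by rewrite ler_wpM2r.
- move=> y y0; have : mu rho * ln 2 <= mu rho * (y - 1 + 2 * expR (- y)).
    by rewrite ler_wpM2l// ln2_le.
  lra.
Qed.

(** This allows rounding [rho] up to a grid at the expense of the [OPT] term only. For the second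
    term of [mu rho'], the tangent condition of [rho] is used at the point [T] of [rho'], together
    with [T * expR (- T) <= 1]; monotonicity of [mu_T] itself is avoided. *)
Lemma mu_antitone rho rho' : rho_range rho -> rho_range rho' -> rho <= rho' ->
  mu rho' <= mu rho.
Proof.
move=> rP r'P rr'.
have [T01 TE] := mu_TP r'P.
have [_ _ tan _] := mu_tradeoff_pair rP.
have e1 : 1 < e by rewrite expR_gt1.
have ln20 : 0 < ln 2 :> R by rewrite ln_gt0// ltr1n.
rewrite {1}/mu ge_max; apply/andP; split.
  rewrite /mu le_max; apply/orP; left.
  have h : 0 <= (e - 1) / e by rewrite divr_ge0 ?expR_ge0// subr_ge0 ltW.
  by rewrite ler_pM2r ?invr_gt0//; apply: lerB => //; exact: ler_wpM2r.
case/andP: T01 TE => T0 T1; set T := mu_T rho' in T0 T1 * => TE.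
have r'0 : 0 < rho' by case/andP: r'P => r'1 _; rewrite (lt_le_trans _ r'1).
have r'T : rho' - 1 = rho' * (T ^+ 2 * expR (- T)).
  by rewrite TE mulrBr divff ?gt_eqF// mulr1.
move: T0; rewrite le_eqVlt => /predU1P[T00|Tp].
  have r'1 : rho' = 1 by move: r'T; rewrite -T00 expr0n /= mul0r mulr0; lra.
  have -> : rho = rho'.
    by apply/eqP; rewrite eq_le rr' r'1; case/andP: rP.
  by rewrite /mu le_max lexx orbT.
rewrite -(ler_pM2r Tp).
have := tan T (ltW Tp).
have : 0 <= (rho' - rho) * (1 - T * expR (- T)).
  rewrite mulr_ge0 ?subr_ge0// mulr_ile1 ?expR_ge0 ?(ltW Tp)//.
  by rewrite -[leRHS]expR0 ler_expR oppr_le0 ltW.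
have -> : rho' * (1 - T) * expR (- T) * T = rho' * T * expR (- T) - (rho' - 1).
  by rewrite r'T; ring.
lra.
Qed.

Lemma rho_max_le : e / (e - 1) <= 9 / 5.
Proof.
have e1 : 1 < e by rewrite expR_gt1.
have : 9 / 4 <= e.
  have -> : e = expR 2^-1 * expR 2^-1 by rewrite -expRD; congr expR; lra.
  have h : 3 / 2 <= expR (2^-1 : R) by have := expR_ge1Dx (2^-1 : R); lra.
  have : 3 / 2 * (3 / 2) <= expR 2^-1 * expR 2^-1 :> R by apply: ler_pM => //;
    lra.
  lra.
by move=> h; rewrite ler_pdivrMr ?subr_gt0//; lra.
Qed.

End TradeoffCurve.

(** * Ski-rental strategies as experts on a convex chain *)

Section SkiExperts.
Variables (R : realType) (D : dpm_system R) (m : nat).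
Variable c : nat -> 'I_(nb_sleep D).+1.
Hypotheses (cP : is_chain m c)
  (cvx : forall i j, (i <= j < m)%N -> chain_scale c i <= chain_scale c j).

Let cS j : (j < m)%N -> (c j < c j.+1)%N. Proof. by case: cP => _ _; exact. Qed.

Let scale_gt0 j : (j < m)%N -> 0 < chain_scale c j.
Proof.
move=> jm; rewrite divr_gt0//; first exact: (chain_price_gt0 cS).
exact: (chain_rate_gt0 cS).
Qed.

Definition ski_layers (rho mu tau : R) (j : nat) (t : R) : R :=
  ski_survival rho mu (tau / chain_scale c j) (t / chain_scale c j).

Section Pair.
Variables (rho mu tau : R).
Hypotheses (rhomu : tradeoff_pair rho mu) (tau0 : 0 <= tau).

Lemma ski_layers_spec : layers_spec m (ski_layers rho mu tau).
Proof.
have y0 j : (j < m)%N -> 0 <= tau / chain_scale c j.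
  by move=> jm; rewrite divr_ge0// ltW// scale_gt0.
have x0 j (t : R) : (j < m)%N -> 0 <= t -> 0 <= t / chain_scale c j.
  by move=> jm t0; rewrite divr_ge0// ltW// scale_gt0.
split.
- move=> j jm t.
  apply: (@continuous_comp R R R (fun t : R => t / chain_scale c j)
    (ski_survival rho mu (tau / chain_scale c j))).
    by apply: cvgM; [exact: cvg_id|exact: cvg_cst].
  exact: continuous_ski_survival.
- by move=> j t jm t0; apply: ski_survival_ge0 => //; exact: y0.
- by move=> j t jm t0; apply: ski_survival_le1 => //; [exact: y0|exact: x0].
- move=> j t t' jm t0 tt'; apply: ski_survival_noninc => //; [exact: y0|exact:
    x0|].
  by rewrite ler_pM2r// invr_gt0 scale_gt0.
- move=> i j t ij t0; apply: ski_survival_scale => //; last exact: cvx.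
  by case/andP: ij => ij jm; rewrite scale_gt0// (leq_ltn_trans ij).
Qed.

Lemma ski_layers_loss (t : R) : 0 <= t ->
  loss m c (ski_layers rho mu tau) t <=
  rho * \sum_(j < m) Num.min (chain_rate c j * t) (chain_price c j) +
  mu * (alpha D ord0 * `|tau - t|).
Proof.
move=> t0.
have mu0 : 0 <= mu by case: rhomu => _ /andP[].
(* The rates sum to the difference of the extreme powers; this is where the errors of all layers add
   up to at most one error weighted by [alpha D ord0]. *)
have rsum : \sum_(j < m) chain_rate c j <= alpha D ord0.
  rewrite -(big_mkord xpredT (chain_rate c)).
  rewrite (telescope_sumr_eq (fun j => - alpha D (c j)))//; last first.
    by move=> j _; rewrite opprK addrC.
  have [-> _ _] := cP; have := alpha_nonneg (c m); lra.
apply: (@le_trans _ _ (rho * (\sum_(j < m) Num.min (chain_rate c j * t)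
  (chain_price c j)) +
    mu * ((\sum_(j < m) chain_rate c j) * `|tau - t|))); last first.
  by rewrite lerD2l ler_wpM2l// ler_wpM2r.
rewrite /loss /rent /wake mulr_suml !mulr_sumr -!big_split /=.
apply: ler_sum => j _.
set s := chain_scale c j; set r := chain_rate c j.
have s0 : 0 < s by exact: scale_gt0.
have r0 : 0 < r by exact: (chain_rate_gt0 cS).
have -> : chain_price c j = r * s by rewrite mulrC divfK// gt_eqF.
have [P0 dP _] := primitiveP (layers_cont ski_layers_spec (ltn_ord j)).
set P := primitive _ in P0 dP *.
(* The primitive in time measured in units of [s]; multiplying the normalised cost bound by the
   price [r * s] returns to the layer. *)
pose q x := P (s * x) / s.
have q0 : q 0 = 0 by rewrite /q mulr0 P0 mul0r.
have dq (x : R) : 0 <= x -> is_derive x 1 q (ski_survival rho mu (tau / s) x).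
  move=> x0; have sx0 : 0 <= s * x by rewrite mulr_ge0// ltW.
  have dPsx := dP _ sx0.
  have ds : is_derive x 1 (fun x : R => s * x) s.
    by apply: is_derive_eq; rewrite /GRing.scale /= mulr1.
  have dc : is_derive x 1 (P \o (fun x => s * x))
      (ski_layers rho mu tau j (s * x) * s) by exact: is_derive1_comp.
  have -> : q = (fun x => (P \o (fun x => s * x)) x / s) by [].
  apply: is_derive_eq; rewrite /GRing.scale /= /ski_layers -/s.
  rewrite mulr0 add0r.
  have -> : s * x / s = x by rewrite mulrAC divff ?mul1r// gt_eqF.
  by field; rewrite gt_eqF.
have y0 : 0 <= tau / s by rewrite divr_ge0// ltW.
have x0 : 0 <= t / s by rewrite divr_ge0// ltW.
have H := ski_survival_cost rhomu y0 q0 dq x0.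
have rs0 : 0 < r * s by rewrite mulr_gt0.
rewrite -(ler_pM2l rs0) in H.
have Pq : r * P t = r * s * q (t / s).
  rewrite /q; have -> : s * (t / s) = t by rewrite mulrC divfK// gt_eqF.
  by field; rewrite gt_eqF.
have minE : r * s * Num.min (t / s) 1 = Num.min (r * t) (r * s).
  rewrite minr_pMr ?(ltW rs0)// mulr1; congr Num.min.
  by field; rewrite gt_eqF.
have absE : r * s * `|tau / s - t / s| = r * `|tau - t|.
  rewrite -mulrBl normrM (ger0_norm (x := s^-1)) ?invr_ge0 ?(ltW s0)//.
  by field; rewrite gt_eqF.
have RE : r * s * (rho * Num.min (t / s) 1 + mu * `|tau / s - t / s|) =
    rho * Num.min (r * t) (r * s) + mu * (r * `|tau - t|).
  by rewrite -minE -absE; ring.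
by move: H; rewrite RE mulrDr -Pq addrC.
Qed.

End Pair.

End SkiExperts.

(** * Assembling the algorithm for a finite grid of tradeoffs *)

Lemma dpm_experts (R : realType) (D : dpm_system R) (n : nat)
    (rhos : 'I_n.+1 -> R) (e : R) :
  (forall i, rho_range (rhos i)) -> 0 < e ->
  exists A : algorithm D, forall inst i,
  (expected_cost A inst <=
   ((1 + e) * (rhos i * OPT D inst + mu (rhos i) * prediction_error D inst) +
    (1 + e) / e * beta D ord_max * ln n.+1%:R)%:E)%E.
Proof.
move=> rP e0.
have [m [c [cP cvx dom]]] := convex_chain D.
have tp i := mu_tradeoff_pair (rP i).
pose g i := ski_layers c (rhos i) (mu (rhos i)).
have gP i tau : 0 <= tau -> layers_spec m (g i tau).
  by move=> tau0; exact: ski_layers_spec.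
pose F t := alpha D ord_max * t +
  \sum_(j < m) Num.min (chain_rate c j * t) (chain_price c j).
have optP inst : \sum_(p <- inst) F (duration p) <= OPT D inst by exact: OPT_ge.
have err0 inst : 0 <= prediction_error D inst.
  by apply: sumr_ge0 => p _; rewrite mulr_ge0 ?alpha_nonneg.
have B0 : 0 <= beta D ord_max by rewrite -(beta0 D) beta_homo.
have Al0 inst : 0 <= \sum_(q <- inst) alpha D ord_max * duration q.
  by apply: sumr_ge0 => q _; rewrite mulr_ge0 ?alpha_nonneg ?duration_ge0.
have lossP i inst : total_loss m c g i inst <=
    rhos i * (\sum_(p <- inst) \sum_(j < m)
      Num.min (chain_rate c j * duration p) (chain_price c j)) +
    mu (rhos i) * prediction_error D inst.
  rewrite /total_loss /prediction_error !mulr_sumr -big_split /=.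
  by apply: ler_sum => p _; apply: ski_layers_loss => //;
    [exact: predicted_ge0|exact: duration_ge0].
have M0 inst : 0 <= \sum_(p <- inst) \sum_(j < m)
    Num.min (chain_rate c j * duration p) (chain_price c j).
  have [_ _ cS] := cP.
  apply: sumr_ge0 => p _; apply: sumr_ge0 => j _.
  rewrite le_min (ltW (chain_price_gt0 cS (ltn_ord j))) andbT.
  by rewrite mulr_ge0 ?duration_ge0// (ltW (chain_rate_gt0 cS (ltn_ord j))).
have AlM inst : \sum_(q <- inst) alpha D ord_max * duration q +
    \sum_(p <- inst) \sum_(j < m)
      Num.min (chain_rate c j * duration p) (chain_price c j) <= OPT D inst.
  by have := optP inst; rewrite /F big_split.
(* The deepest-state rent [a] is not part of the loss; as [1 <= rhos i], it is absorbed through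
   [rhos i * (a + M) <= rhos i * OPT D inst]. *)
have combine i inst (a M L : R) : 0 <= a -> 0 <= M -> a + M <= OPT D inst ->
    L <= rhos i * M + mu (rhos i) * prediction_error D inst ->
    a + (1 + e) * L <= (1 + e) *
      (rhos i * OPT D inst + mu (rhos i) * prediction_error D inst).
  move=> a0 M_ge0 aM LM; have [r1 /andP[mu0 _] _ _] := tp i.
  have h1 : rhos i * (a + M) <= rhos i * OPT D inst.
    by rewrite ler_wpM2l// (le_trans ler01).
  have h2 : a <= rhos i * a by rewrite ler_peMl.
  have h3 : 0 <= e * (rhos i * a) by rewrite !mulr_ge0 ?(ltW e0)// (le_trans
    ler01).
  have h4 : (1 + e) * (rhos i * a + L) <= (1 + e) *
      (rhos i * OPT D inst + mu (rhos i) * prediction_error D inst).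
    by rewrite ler_wpM2l ?addr_ge0 ?(ltW e0)//; move: h1 LM; lra.
  by move: h4; lra.
have [Bpos|Ble] := ltP 0 (beta D ord_max).
  (* With this choice the factor [1 + lam * beta D ord_max] of the mixture is [1 + e]. *)
  have lam0 : 0 < e / beta D ord_max by rewrite divr_gt0.
  have [A AP] := hedge cP gP lam0.
  exists A => inst i; apply: (le_trans (AP inst i)); rewrite lee_fin.
  have -> : (1 + e / beta D ord_max * beta D ord_max) / (e / beta D ord_max) *
      (ln n.+1%:R + e / beta D ord_max * total_loss m c g i inst) =
      (1 + e) * total_loss m c g i inst +
      (1 + e) / e * beta D ord_max * ln n.+1%:R.
    by field; rewrite !gt_eqF.
  by rewrite addrA lerD2r; exact: (combine i inst _ _ _ (Al0 _) (M0 _) (AlM _)).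
(* Without sleep states there is nothing to decide: the loss vanishes. *)
have BE : beta D ord_max = 0 by apply/eqP; rewrite eq_le Ble.
have m0 : m = 0%N.
  case: (posnP m) => // m_gt0; have [c0 _ cS] := cP.
  have := beta_incr (cS _ m_gt0); rewrite c0 beta0 => c1.
  have := lt_le_trans c1 (beta_homo (leq_ord (c 1%N) : (_ <= ord_max)%N)).
  by rewrite BE ltxx.
have [A AP] := hedge (n := 0%N) cP (fun=> gP ord0) (@ltr01 R).
exists A => inst i; apply: (le_trans (AP inst ord0)); rewrite lee_fin.
have -> : total_loss m c (fun=> g ord0) ord0 inst = 0.
  rewrite /total_loss big1// => p _.
  by rewrite /loss /rent /wake m0 !big_ord0 addr0.
rewrite BE !mulr0 addr0 ln1 addr0 mulr0 mul0r !addr0.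
have := combine i inst _ _ 0 (Al0 _) (M0 _) (AlM _).
rewrite mulr0 addr0; apply.
have [r1 /andP[mu0 _] _ _] := tp i.
by rewrite addr_ge0// mulr_ge0// (le_trans ler01).
Qed.

Lemma expected_cost_ge0 (R : realType) (D : dpm_system R) (A : algorithm D)
  inst :
  (0 <= expected_cost A inst)%E.
Proof.
rewrite /expected_cost unlock; apply: integral_ge0 => w _; rewrite lee_fin
  /cost.
elim: inst [::] => //= q inst IH past.
by rewrite addr_ge0// period_cost_ge0// duration_ge0.
Qed.

(** The algorithm is the same for all [rho], so the bounds pass to the infimum once the expected
    cost is known to be finite. *)
Lemma expected_cost_le_inf (R : realType) (D : dpm_system R) (A : algorithm D)
    inst (k X : R) : 0 < k ->
  (forall rho, rho_range rho -> (expected_cost A inst <=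
    (k * (rho * OPT D inst + mu rho * prediction_error D inst) + X)%:E)%E) ->
  (expected_cost A inst <= (k * inf [set rho * OPT D inst +
     mu rho * prediction_error D inst | rho in @rho_range R] + X)%:E)%E.
Proof.
move=> k0 H; set S := [set _ | _ in _].
have : expected_cost A inst \is a fin_num.
  rewrite ge0_fin_numE ?expected_cost_ge0//.
  by apply: le_lt_trans (H _ (rho_range1 R)) _; rewrite ltry.
move=> /fineK EE; rewrite -EE lee_fin -lerBlDr mulrC -ler_pdivrMr//.
apply: lb_le_inf; first by eexists; exists 1; [exact: rho_range1|].
move=> _ [rho rP <-]; rewrite ler_pdivrMr// lerBlDr mulrC -lee_fin EE.
exact: H.
Qed.

Theorem theorem5 (R : realType) :
  exists C : R, forall eps : R, 0 < eps ->
  exists A : forall D : dpm_system R, algorithm D,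
  forall (D : dpm_system R) (inst : seq (period R)),
    (expected_cost (A D) inst <=
     ((1 + eps) *
        inf [set rho * OPT D inst + mu rho * prediction_error D inst
            | rho in @rho_range R]
      + C * `|beta D ord_max / eps * ln (1 / eps)|)%:E)%E.
Proof.
(* For [eps < 9 / 10] the estimates below need [4 * 41 = 164]. *)
exists 200 => eps eps0.
suff H (D : dpm_system R) : exists A : algorithm D,
    forall inst rho, rho_range rho -> (expected_cost A inst <=
      ((1 + eps) * (rho * OPT D inst + mu rho * prediction_error D inst) +
       200 * `|beta D ord_max / eps * ln (1 / eps)|)%:E)%E.
  exists (fun D => projT1 (cid (H D))) => D inst.
  apply: expected_cost_le_inf; first by rewrite addr_gt0.
  exact: (projT2 (cid (H D))).
have err0 inst : 0 <= prediction_error D inst.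
  by apply: sumr_ge0 => p _; rewrite mulr_ge0 ?alpha_nonneg.
have opt0 inst : 0 <= OPT D inst.
  apply: le_trans (@OPT_ge R D (fun=> 0) inst _); first by rewrite big1.
  move=> i t t0; rewrite addr_ge0 ?mulr_ge0 ?alpha_nonneg//.
  by rewrite -(beta0 D) beta_homo.
have B0 : 0 <= beta D ord_max by rewrite -(beta0 D) beta_homo.
pose rmax : R := expR 1 / (expR 1 - 1).
have rmaxP : rho_range rmax.
  rewrite /rho_range /= lexx andbT.
  by case/andP: (rho_range1 R).
have rmax95 : rmax <= 9 / 5 by exact: rho_max_le.
(* The logarithm vanishes at [eps = 1], so for large [eps] a single expert is taken, whose additive
   term is [ln 1 = 0]; it suffices because [(1 + 1 / 20) * (9 / 5) <= 1 + 9 / 10]. *)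
have [big|small] := leP (9 / 10) eps.
  have [|A AP] := @dpm_experts R D 0 (fun=> rmax) (1 / 20) (fun=> rmaxP).
    by lra.
  exists A => inst rho rP; apply: (le_trans (AP inst ord0)); rewrite lee_fin.
  rewrite ln1 mulr0 addr0 ler_wpDr ?mulr_ge0//.
  have [r1 re] := andP rP.
  have mule := mu_antitone rP rmaxP re.
  have [_ /andP[mu0 _] _ _] := mu_tradeoff_pair rP.
  have h1 : rmax * OPT D inst <= 9 / 5 * OPT D inst by rewrite ler_wpM2r.
  have h2 : mu rmax * prediction_error D inst <= mu rho * prediction_error D
    inst.
    by rewrite ler_wpM2r.
  have h3 : OPT D inst <= rho * OPT D inst by rewrite ler_peMl.
  have h4 : 0 <= (eps - 9 / 10) *
      (rho * OPT D inst + mu rho * prediction_error D inst).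
    rewrite mulr_ge0 ?subr_ge0// addr_ge0 ?mulr_ge0//.
    by rewrite (le_trans ler01).
  have h5 : 0 <= mu rho * prediction_error D inst by rewrite mulr_ge0.
  by have := opt0 inst; lra.
have d0 : 0 < eps / 3 by rewrite divr_gt0.
(* A grid of step [eps / 3] from 1 to beyond [rmax], which is less than 2; the successor leaves room
   for rounding up. *)
pose n := (Num.truncn (3 / eps)).+1.
pose rhos (i : 'I_n.+1) : R := Num.min (1 + i%:R * (eps / 3)) rmax.
have rhosP i : rho_range (rhos i).
  rewrite /rho_range /= ge_min lexx orbT andbT le_min.
  rewrite lerDl mulr_ge0 ?(ltW d0)//=.
  by case/andP: rmaxP.
have [A AP] := @dpm_experts R D n rhos (eps / 3) rhosP d0.
exists A => inst rho rP.
have [r1 re] := andP rP.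
have [i [ri ir]] : exists i, rho <= rhos i /\ rhos i <= rho + eps / 3.
  set x := (rho - 1) / (eps / 3).
  have x0 : 0 <= x by rewrite divr_ge0 ?subr_ge0// ltW.
  have xE : x * (eps / 3) = rho - 1 by rewrite divfK// gt_eqF.
  have xn : x <= 3 / eps.
    rewrite /x ler_pdivrMr//.
    have -> : 3 / eps * (eps / 3) = 1 by field; rewrite gt_eqF.
    by have := le_trans re rmax95; lra.
  have kn : ((Num.truncn x).+1 < n.+1)%N by rewrite !ltnS le_truncn.
  have /andP[kx xk] := truncn_itv x0.
  exists (Ordinal kn); rewrite /rhos /=; split.
    rewrite le_min re andbT -lerBlDl -xE ler_pM2r//; exact: ltW.
  rewrite ge_min; apply/orP; left.
  have : (Num.truncn x)%:R * (eps / 3) <= x * (eps / 3) by rewrite ler_pM2r.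
  by rewrite xE -[_.+1]addn1 natrD; lra.
apply: (le_trans (AP inst i)); rewrite lee_fin.
apply: lerD.
  have mule := mu_antitone rP (rhosP i) ri.
  have [_ /andP[mu0 _] _ _] := mu_tradeoff_pair rP.
  have h1 : rhos i * OPT D inst <= (1 + eps / 3) * (rho * OPT D inst).
    rewrite mulrA ler_wpM2r// (le_trans ir)//.
    have : eps / 3 <= eps / 3 * rho by rewrite ler_peMr// ltW.
    lra.
  have h2 : mu (rhos i) * prediction_error D inst <= mu rho * prediction_error
    D inst.
    by rewrite ler_wpM2r.
  have h5 : 0 <= mu rho * prediction_error D inst by rewrite mulr_ge0.
  have h6 : 0 <= rho * OPT D inst by rewrite mulr_ge0// (le_trans ler01).
  set Y := rho * OPT D inst + mu rho * prediction_error D inst.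
  have Y0 : 0 <= Y by rewrite addr_ge0.
  (* One factor comes from combining the experts, the other from rounding [rho]. *)
  apply: (@le_trans _ _ ((1 + eps / 3) * ((1 + eps / 3) * Y))).
    rewrite ler_wpM2l ?addr_ge0 ?(ltW d0)// /Y mulrDr lerD//.
    rewrite (le_trans h2)// ler_peMl// lerDl ltW//.
  rewrite mulrA ler_wpM2r//.
  nra.
set L := ln (1 / eps).
have L10 : 1 / 10 <= L.
  have -> : L = - ln eps by rewrite /L div1r lnV ?posrE.
  have : ln eps <= eps - 1.
    by have := @le_ln1Dx R (eps - 1); rewrite addrCA subrr addr0; apply; lra.
  lra.
have nle : n.+1%:R <= 5 * (1 / eps).
  have e0 : 0 <= 3 / eps by rewrite divr_ge0// ltW.
  have /andP[kx _] := truncn_itv e0.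
  have : 1 <= 1 / eps by rewrite ler_pdivlMr// mul1r; lra.
  rewrite /n -[_.+2]addn2 natrD; move: kx; lra.
(* The constant [ln 5 <= 4] is absorbed into [40 * L] by [1 / 10 <= L]. *)
have lnn : ln n.+1%:R <= 41 * L.
  have eV0 : 0 < 1 / eps by rewrite divr_gt0.
  have : ln n.+1%:R <= ln (5 * (1 / eps)) :> R.
    by rewrite ler_ln ?posrE ?ltr0Sn//; exact: mulr_gt0.
  rewrite lnM ?posrE// -/L.
  have := @le_ln1Dx R 4; have -> : 1 + 4 = 5 :> R by lra.
  move=> /(_ ltac:(lra)); lra.
have Be0 : 0 <= beta D ord_max / eps by rewrite divr_ge0// ltW.
rewrite ger0_norm; last by rewrite mulr_ge0//; lra.
have -> : (1 + eps / 3) / (eps / 3) * beta D ord_max * ln n.+1%:R =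
    beta D ord_max / eps * ((3 + eps) * ln n.+1%:R) by field; rewrite gt_eqF.
rewrite [leRHS]mulrCA ler_wpM2l//.
have lnn0 : 0 <= ln n.+1%:R :> R by rewrite ln_ge0// ler1n.
have : (3 + eps) * ln n.+1%:R <= 4 * ln n.+1%:R by rewrite ler_wpM2r//; lra.
lra.
Qed.
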